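(* (a) Let $\sigma,\sigma'\in\mathcal W$ and let $\Theta,\Theta'\subseteq I$ be special. Then $$\sigma'R(\Theta')\subseteq\sigma R(\Theta)\iff\Theta'\supseteq\Theta\ \text{ and }\ \sigma^{-1}\sigma'\in\mathcal W_{\Theta^\bot}\mathcal W_{\Theta'} .$$ Different faces of $X$ of the same type are not comparable by $\subseteq$. (b) Let $\Theta_1,\Theta_2\subseteq I$ be special and let $\tau\in{}^{\Theta_1\cup\Theta_1^\bot}\mathcal W^{\Theta_2\cup\Theta_2^\bot}$. Then $$R(\Theta_1)\cap\tau R(\Theta_2)=R\big(\Theta_1\cup\Theta_2\cup red(\tau)\big),$$ $$R(\Theta_1)\vee\tau R(\Theta_2)=R\big((\Theta_1\cap\tau\Theta_2)^\infty\big),$$ where $\vee$ denotes the join in the lattice of faces of the Tits cone $X$.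
   Context: $A=(a_{ij})_{i,j\in I}$ ($I$ finite) is a symmetrizable generalized Cartan matrix with a minimal realization over $\mathbb R$: a real vector space $\mathfrak h_{\mathbb R}$ of dimension $2|I|-\mathrm{rank}\,A$, linearly independent $(h_i)_{i\in I}$ in $\mathfrak h_{\mathbb R}$ and linearly independent $(\alpha_i)_{i\in I}$ in $\mathfrak h_{\mathbb R}^*$ with $\alpha_j(h_i)=a_{ij}$. The Weyl group $\mathcal W$ is the Coxeter group generated by the simple reflections $\sigma_i$ ($i\in I$), acting on $\mathfrak h_{\mathbb R}^*$ by $\sigma_i\lambda=\lambda-\lambda(h_i)\alpha_i$. For $J\subseteq I$: $\mathcal W_J=\langle\sigma_j\mid j\in J\rangle$; $\mathcal W^J$ (resp. ${}^J\mathcal W$) is the set of minimal length representatives of the cosets $\mathcal W/\mathcal W_J$ (resp. $\mathcal W_J\backslash\mathcal W$); ${}^K\mathcal W^J={}^K\mathcal W\cap\mathcal W^J$ (minimal double coset representatives). $red(\sigma)\subseteq I$ is the set of indices of the simple reflections occurring in a (any) reduced expression of $\sigma\in\mathcal W$ ($red(1)=\emptyset$). $I$ is identified with the set of simple roots, so $K\cap\sigma J=\{i\in K\mid\alpha_i=\sigma\alpha_j\text{ for some }j\in J\}$. $J^\bot=\{i\in I\mid a_{ij}=0\ \forall j\in J\}$. $J^\infty$ is the union of the connected components of $J$ for which the corresponding submatrix of $A$ is not of finite type ($\emptyset^\infty=\emptyset$). $\Theta\subseteq I$ is special if $\Theta=\Theta^\infty$. The Tits cone is $X=\mathcal W\overline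 C$, $\overline C=\{\lambda\in\mathfrak h_{\mathbb R}^*\mid\lambda(h_i)\ge0\ \forall i\in I\}$. A face of $X$ is a (nonempty) face of the convex cone $X$ in the sense of convex geometry. The set of faces, ordered by inclusion, is a complete lattice; the lattice meet of two faces is their set-theoretic intersection. For special $\Theta$, $R(\Theta)=\mathcal W_{\Theta^\bot}\{\lambda\in\overline C\mid\lambda(h_i)=0\ \forall i\in\Theta\}=\{\lambda\in X\mid\lambda(h_i)=0\ \forall i\in\Theta\}$, which is a face of $X$. Every face of $X$ can be written as $\sigma R(\Theta)$ with $\sigma\in\mathcal W$ and a uniquely determined special set $\Theta$, called the type of the face. (Part of the first formula in (b) is that $\Theta_1\cup\Theta_2\cup red(\tau)$ is special.) *)

(* Defs.v *)
From HB Require Import structures.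
From mathcomp Require Import all_boot all_order all_algebra.
From mathcomp Require Import boolp classical_sets reals.

Set Implicit Arguments.
Unset Strict Implicit.
Unset Printing Implicit Defensive.

Import Order.TTheory GRing.Theory Num.Theory.
Local Open Scope classical_set_scope.
Local Open Scope ring_scope.

(* Integer matrices indexed by I are functions A : I -> I -> int, so that the
   index set can be an arbitrary finite type. *)

Definition gen_cartan_mx (I : finType) (A : I -> I -> int) : Prop :=
  [/\ forall i, A i i = 2,
      forall i j, i != j -> A i j <= 0
    & forall i j, A i j = 0 -> A j i = 0].

(* The diagonal matrix diag(d) is invertible with positive entries and
   diag(d) * A is symmetric. *)
Definition symmetrizable (R : realType) (I : finType) (A : I -> I -> int) :
    Prop :=
  exists2 d : I -> R,
    forall i, 0 < d i
    & forall i j, d i * (A i j)%:~R = d j * (A j i)%:~R.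

Definition principal_submx (R : realType) (I : finType) (A : I -> I -> int)
    (J : {set I}) : 'M[R]_#|J| :=
  \matrix_(i, j) (A (enum_val i) (enum_val j))%:~R.

(* Condition (Fin) in Kac's trichotomy of indecomposable generalized Cartan
   matrices into finite, affine and indefinite type. *)
Definition finite_type (R : realType) n (B : 'M[R]_n) : Prop :=
  [/\ \det B != 0,
      exists u : 'cV[R]_n,
        (forall i, 0 < u i 0) /\ (forall i, 0 < (B *m u) i 0)
    & forall v : 'cV[R]_n,
        (forall i, 0 <= (B *m v) i 0) -> (forall i, 0 < v i 0) \/ v = 0].

Definition dynkin_edge (I : finType) (A : I -> I -> int) (J : {set I}) :
    rel I :=
  fun i j => [&& i \in J, j \in J & A i j != 0].

Definition dynkin_components (I : finType) (A : I -> I -> int) (J : {set I}) :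
    {set {set I}} :=
  [set [set j in connect (dynkin_edge A J) i] | i in J]%SET.

Definition infty_part (R : realType) (I : finType) (A : I -> I -> int)
    (J : {set I}) : {set I} :=
  finset.cover [set K in dynkin_components A J
                 | ~~ `[< finite_type (principal_submx R A K) >]]%SET.

Definition special (R : realType) (I : finType) (A : I -> I -> int)
    (J : {set I}) : Prop :=
  J = infty_part R A J.

Definition perp (I : finType) (A : I -> I -> int) (J : {set I}) : {set I} :=
  [set i | [forall j in J, A i j == 0]]%SET.

Record minimal_realization (R : realType) (I : finType) (A : I -> I -> int)
    (h : vectType R) := MinimalRealization {
  coroot : I -> h;
  root : I -> 'Hom(h, R^o);
  dim_realization :
    \dim {:h} = (2 * #|I| - \rank (principal_submx R A [set: I]))%N;
  free_coroot : free [seq coroot i | i : I];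
  free_root : free [seq root i | i : I];
  root_coroot : forall i j, root j (coroot i) = (A i j)%:~R
}.

Section WeylGroup.
Variables (R : realType) (I : finType) (A : I -> I -> int) (h : vectType R).
Variable D : minimal_realization A h.

Local Notation hdual := 'Hom(h, R^o).

Definition simple_refl_fun (i : I) (l : hdual) : hdual :=
  l - (l (coroot D i) : R) *: root D i.

Fact simple_refl_fun_linear i : linear (simple_refl_fun i).
Proof.
move=> a u v; rewrite /simple_refl_fun add_lfunE scale_lfunE.
by rewrite scalerDl scalerBr -scalerA opprD addrACA.
Qed.

HB.instance Definition _ i := GRing.isLinear.Build R hdual hdual *:%R
  (simple_refl_fun i) (simple_refl_fun_linear i).

Definition simple_refl (i : I) : 'End(hdual) := linfun (simple_refl_fun i).

Fact simple_reflE i l :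
  simple_refl i l = l - (l (coroot D i) : R) *: root D i.
Proof. by rewrite lfunE. Qed.

(* Elements of the Weyl group are the endomorphisms of the dual space that are
   products of simple reflections; products are compositions. *)
Definition word_prod (s : seq I) : 'End(hdual) :=
  foldr (fun i w => (simple_refl i \o w)%VF) \1%VF s.

Definition parabolic (J : {set I}) : set 'End(hdual) :=
  [set w | exists2 s : seq I, all (mem J) s & w = word_prod s].

Definition weyl : set 'End(hdual) := parabolic [set: I].

Definition reduced_word (w : 'End(hdual)) (s : seq I) : Prop :=
  w = word_prod s /\ forall t, w = word_prod t -> (size s <= size t)%N.

(* The default value of get is irrelevant: length is used on weyl only. *)
Definition weyl_length (w : 'End(hdual)) : nat :=
  get [set n | exists2 s, reduced_word w s & size s = n].

(* The set of indices does not depend on the reduced expression. *)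
Definition red (w : 'End(hdual)) : {set I} :=
  [set i | `[< exists2 s, reduced_word w s & i \in s >]]%SET.

(* Minimal length representatives of the cosets w W_J. *)
Definition min_repr (J : {set I}) : set 'End(hdual) :=
  [set w | weyl w /\ forall u, parabolic J u ->
             (weyl_length w <= weyl_length (w \o u)%VF)%N].

(* Minimal length representatives of the cosets W_K w. *)
Definition min_lrepr (K : {set I}) : set 'End(hdual) :=
  [set w | weyl w /\ forall u, parabolic K u ->
             (weyl_length w <= weyl_length (u \o w)%VF)%N].

Definition min_double_repr (K J : {set I}) : set 'End(hdual) :=
  min_lrepr K `&` min_repr J.

(* K :&: w J, where I is identified with the set of simple roots. *)
Definition cap_image (K : {set I}) (w : 'End(hdual)) (J : {set I}) : {set I} :=
  [set i in K | [exists j in J, root D i == w (root D j)]]%SET.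

Definition closed_chamber : set hdual :=
  [set l | forall i, 0 <= (l (coroot D i) : R)].

Definition tits_cone : set hdual :=
  [set m | exists w l, [/\ weyl w, closed_chamber l & m = w l]].

Definition is_face (F : set hdual) : Prop :=
  [/\ F !=set0,
      F `<=` tits_cone,
      forall x y (t : R), F x -> F y -> 0 <= t <= 1 ->
        F (t *: x + (1 - t) *: y)
    & forall x y (t : R), tits_cone x -> tits_cone y -> 0 < t < 1 ->
        F (t *: x + (1 - t) *: y) -> F x /\ F y].

(* H is the least upper bound of F and G among the faces, for inclusion. *)
Definition is_face_join (F G H : set hdual) : Prop :=
  [/\ is_face H, F `<=` H, G `<=` H
    & forall H', is_face H' -> F `<=` H' -> G `<=` H' -> H `<=` H'].

Definition Rface (J : {set I}) : set hdual :=
  [set m | exists w l, [/\ parabolic (perp A J) w, closed_chamber l,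
                           forall i, i \in J -> l (coroot D i) = 0
                         & m = w l]].

Definition has_face_type (F : set hdual) (J : {set I}) : Prop :=
  special R A J /\ exists2 w, weyl w & F = w @` Rface J.

End WeylGroup.

(* Main.v *)
Require Import Defs.
From mathcomp Require Import all_boot all_order all_algebra.
From mathcomp Require Import zify ring lra.
From mathcomp Require Import boolp classical_sets reals.

Set Implicit Arguments.
Unset Strict Implicit.
Unset Printing Implicit Defensive.

Import Order.TTheory GRing.Theory Num.Theory.
Local Open Scope classical_set_scope.
Local Open Scope ring_scope.

(** Special sets are handled through sign conditions. A set T is special when
    some vector with positive entries on T, and zero entries elsewhere, is
    mapped by A to a vector with nonpositive entries (special_witnessed). The
    symmetrizer turns such a vector into a functional on weights that is
    nonpositive on every simple root and nonnegative on the Tits cone X. Its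
    zero set on X is R(T), which shows at once that R(T) is a face and that it
    consists of the points of X on which the coroots of T vanish (RfaceE,
    Rface_is_face). Dually, a set of finite type carries a positive vector
    with positive image; its root system is then finite, so every weight is
    conjugate to one that is dominant on that set (fin_dominant_conjugate).
    Convexity of X follows from the same counting of the positive roots on
    which a weight is negative (dominant_conjugate).

    The Weyl group enters through the fact that a root is positive or negative
    (root_sign_coherent), which reduces to rank two, where an invariant
    integral quadratic form excludes coefficients of opposite signs. Deletion,
    exchange and the description of stabilizers of dominant weights follow.

    For the inclusion of faces, follow a dominant weight with stabilizer
    exactly W_T': its image in the larger face is conjugate to it under the
    orthogonal parabolic subgroup, and the quotient of the two elements lies
    in its stabilizer (word_Rface_subset).

    For the meet, a common point has a single dominant representative l. It is
    fixed by the double coset representative w: minimality makes l - w l a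
    nonnegative combination of simple roots that w^-1 keeps positive, whereas
    w^-1 maps it to w^-1 l - l, which is nonpositive (double_coset_fix). Supports of differences of weights then show that the
    common point stays in the face R of the union (Rface_meet). That this
    union is special comes from maximality: a letter of w not attached to the
    special part would be a descent of w (inf_witnessed_red).

    For the join, any face that contains a dominant l contains R of the
    infinite part of the set of simple coroots vanishing at l
    (face_contains_Rface). The midpoint of suitable weights of the two faces
    is dominant and vanishes only where a simple root of T1 is the image of one
    of T2 (Rface_join). *)

(** * Finite and infinite type through sign conditions *)

Section CartanMatrix.
Variables (R : realType) (I : finType) (A : I -> I -> int).
Hypothesis A_gcm : gen_cartan_mx A.

Local Notation a i j := ((A i j)%:~R : R).
Implicit Types (i j k : I) (J K S M : {set I}) (c u y v : I -> R).

Definition cartan_mul c i : R := \sum_j a i j * c j.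

Lemma gcm_diag i : a i i = 2.
Proof. by case: A_gcm => -> _ _. Qed.

Lemma gcm_off i j : i != j -> a i j <= 0.
Proof. by case: A_gcm => _ + _ => /[apply]; rewrite lerz0. Qed.

Lemma gcm_sym0 i j : (A i j == 0) = (A j i == 0).
Proof. by case: A_gcm => _ _ A0; apply/eqP/eqP => /A0. Qed.

Lemma cartan_mulD c1 c2 i :
  cartan_mul (fun j => c1 j + c2 j) i = cartan_mul c1 i + cartan_mul c2 i.
Proof. by rewrite -big_split; apply: eq_bigr => j _; rewrite mulrDr. Qed.

Lemma cartan_mulZ t c i : cartan_mul (fun j => t * c j) i = t * cartan_mul c i.
Proof. by rewrite mulr_sumr; apply: eq_bigr => j _; rewrite mulrCA. Qed.

Lemma cartan_mul_delta k i : cartan_mul (fun j => (j == k)%:R) i = a i k.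
Proof.
rewrite /cartan_mul (bigD1 k) //= eqxx mulr1 big1 ?addr0 // => j /negPf ->.
by rewrite mulr0.
Qed.

Lemma cartan_mul_off_le0 c i :
  (forall j, 0 <= c j) -> c i = 0 -> cartan_mul c i <= 0.
Proof.
move=> c0 ci; apply: sumr_le0 => j _; have [<-|ij] := eqVneq i j.
  by rewrite ci mulr0.
by rewrite mulr_le0_ge0 ?gcm_off.
Qed.

(** A theorem of the alternative for matrices with nonpositive off-diagonal
    entries. The signs make Gaussian elimination preserve nonnegativity, so
    that adding one index at a time suffices. *)
Lemma zmx_alternative J :
  (exists y, [/\ forall i, 0 <= y i, forall i, i \notin J -> y i = 0,
                 exists i, 0 < y i & forall i, i \in J -> cartan_mul y i <= 0]) \/
  (forall b : I -> R, (forall i, 0 <= b i) ->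
     exists v, [/\ forall i, 0 <= v i, forall i, i \notin J -> v i = 0
                 & forall i, i \in J -> cartan_mul v i = b i]).
Proof.
have [n] := ubnP #|J|; elim: n J => // n IH J ltJn.
have [->|[k kJ]] := set_0Vmem J.
  by right=> b b0; exists (fun _ => 0); split=> // i; rewrite inE.
have JE i : (i \in J) = (i == k) || (i \in J :\ k).
  by rewrite !inE; case: eqP => // ->.
have kJ' : k \notin J :\ k by rewrite !inE eqxx.
case: (IH (J :\ k)); first by move: ltJn; rewrite (cardsD1 k) kJ.
  case=> y [y0 yJ [i yi] yle]; left; exists y; split=> //.
  - by move=> j; rewrite JE negb_or => /andP[_ /yJ].
  - by exists i.
  - move=> j; rewrite JE => /orP[/eqP ->|/yle //].
    by apply: cartan_mul_off_le0 => //; apply: yJ.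
move=> solve.
have [i|v [v0 vJ vE]] := solve (fun i => if i == k then 0 else - a i k).
  by case: ifP => [_ //|/negbT ik]; rewrite oppr_ge0 gcm_off.
(* The solution on J minus k is completed by 1 at k: A z then vanishes on
   J minus k, and the sign of its entry at k decides the alternative. *)
pose z j := v j + (j == k)%:R.
have z0 i : 0 <= z i by rewrite addr_ge0 // ler0n.
have zJ i : i \notin J -> z i = 0.
  by rewrite JE negb_or /z => /andP[/negPf -> /vJ ->]; rewrite addr0.
have zE i : i \in J :\ k -> cartan_mul z i = 0.
  move=> iJ; rewrite cartan_mulD vE // cartan_mul_delta ifF ?addNr //.
  by apply/negbTE; move: iJ; rewrite !inE => /andP[].
have [p0|p0] := leP (cartan_mul z k) 0.
  left; exists z; split=> //.
    by exists k; rewrite /z eqxx ltr_wpDl.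
  by move=> i; rewrite JE => /orP[/eqP -> //|/zE ->].
right=> b b0; have [w [w0 wJ wE]] := solve b b0.
have wk : cartan_mul w k <= 0 by apply: cartan_mul_off_le0 => //; apply: wJ.
pose t := (b k - cartan_mul w k) / cartan_mul z k.
have t0 : 0 <= t.
  by rewrite divr_ge0 ?(ltW p0) // subr_ge0 (le_trans wk).
exists (fun j => w j + t * z j); split=> [i|i iJ|i].
- by rewrite addr_ge0 // mulr_ge0.
- rewrite zJ // mulr0 addr0 wJ //.
  by move: iJ; rewrite JE negb_or => /andP[].
- rewrite cartan_mulD cartan_mulZ JE => /orP[/eqP ->|iJ].
    by rewrite divfK ?gt_eqF // addrC subrK.
  by rewrite zE // mulr0 addr0 wE.
Qed.

(** The two sign conditions stand for the types of the components of J: they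
    are all of finite type when J has a positive vector with positive image,
    and none is when J has a positive vector with nonpositive image. *)
Definition fin_witnessed J : Prop :=
  exists u, [/\ forall i, i \in J -> 0 < u i, forall i, i \notin J -> u i = 0
              & forall i, i \in J -> 0 < cartan_mul u i].

Definition inf_witnessed J : Prop :=
  exists c, [/\ forall i, i \in J -> 0 < c i, forall i, i \notin J -> c i = 0
              & forall i, i \in J -> cartan_mul c i <= 0].

Lemma witness_ge0 J c :
  (forall i, i \in J -> 0 < c i) -> (forall i, i \notin J -> c i = 0) ->
  forall i, 0 <= c i.
Proof.
move=> c0 c1 i; have [/c0 /ltW //|/c1 ->] := boolP (i \in J).
exact: lexx.
Qed.

Lemma inf_witnessedU S J :
  inf_witnessed S -> inf_witnessed J -> inf_witnessed (S :|: J).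
Proof.
move=> [c [c0 c1 c2]] [e [e0 e1 e2]].
have c3 := witness_ge0 c0 c1; have e3 := witness_ge0 e0 e1.
exists (fun i => c i + e i); split=> i; rewrite inE.
- by case/orP => [/c0 ?|/e0 ?]; [apply: ltr_pwDl | apply: ltr_wpDl].
- by rewrite negb_or => /andP[/c1 -> /e1 ->]; rewrite addr0.
- move=> iSJ; rewrite cartan_mulD -[leRHS]addr0; apply: lerD.
    by have [/c2 //|/c1/(cartan_mul_off_le0 c3)] := boolP (i \in S).
  by have [/e2 //|/e1/(cartan_mul_off_le0 e3)] := boolP (i \in J).
Qed.

Lemma inf_witnessed0 : inf_witnessed finset.set0.
Proof. by exists (fun _ => 0); split=> i; rewrite inE. Qed.

(** An index connected to J has a strictly negative entry in the image of the
    witness, which leaves room for a small positive coefficient there. *)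
Lemma inf_witnessed_add J k :
  inf_witnessed J -> k \notin J -> k \notin perp A J -> inf_witnessed (k |: J).
Proof.
move=> [c [c0 c1 c2]] kJ; rewrite inE negb_forall => /existsP[j].
rewrite negb_imply => /andP[jJ akj].
have c3 := witness_ge0 c0 c1; have kj : k != j by apply: contraNneq kJ => ->.
have ck : cartan_mul c k < 0.
  rewrite /cartan_mul (bigD1 j) //= -[ltRHS]addr0; apply: ltr_leD.
    by rewrite nmulr_rlt0 ?c0 // lt_neqAle gcm_off // intr_eq0 akj.
  apply: sumr_le0 => i _; have [->|ki] := eqVneq i k; first by rewrite c1 ?mulr0.
  by rewrite mulr_le0_ge0 // gcm_off // eq_sym.
(* The diagonal entry 2 limits the new coefficient to half the slack at k. *)
pose t := - cartan_mul c k / 2.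
have t0 : 0 < t by rewrite divr_gt0 ?oppr_gt0.
exists (fun i => c i + t * (i == k)%:R); split=> i; rewrite !inE.
- case/orP=> [/eqP ->|iJ]; first by rewrite eqxx c1 // add0r mulr1.
  by rewrite ltr_pwDl ?c0 // mulr_ge0 ?ler0n ?ltW.
- by rewrite negb_or => /andP[/negPf -> /c1 ->]; rewrite mulr0 addr0.
- rewrite cartan_mulD cartan_mulZ cartan_mul_delta => /orP[/eqP ->|iJ].
    by rewrite gcm_diag /t divfK ?pnatr_eq0 // addrN.
  rewrite -[leRHS]addr0 lerD ?c2 // mulr_ge0_le0 ?(ltW t0) // gcm_off //.
  by apply: contraNneq kJ => <-.
Qed.

Lemma inf_or_fin_witnessed J :
  (exists S, [/\ S \subset J, S != finset.set0 & inf_witnessed S]) \/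
  fin_witnessed J.
Proof.
case: (zmx_alternative J) => [[y [y0 yJ [i yi] yle]]|solve].
  have SJ : [set j | 0 < y j]%SET \subset J.
    apply/fintype.subsetP => j; rewrite inE => yj.
    by apply: contraLR yj => /yJ ->; rewrite ltxx.
  left; exists [set j | 0 < y j]%SET; split=> //.
    by apply/finset.set0Pn; exists i; rewrite inE.
  exists y; split=> j; first by rewrite inE.
    by rewrite inE => /negP yj; apply/eqP; rewrite eq_le y0 andbT leNgt; apply/negP.
  by move=> /(fintype.subsetP SJ)/yle.
have [//|u [u0 uJ uE]] := solve (fun _ => 1).
right; exists u; split=> // i iJ; last by rewrite uE.
rewrite lt_neqAle u0 andbT eq_sym; apply/eqP => ui.
by have := cartan_mul_off_le0 u0 ui; rewrite uE // ler10.
Qed.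

Definition inf_core J : {set I} :=
  \bigcup_(S : {set I} | (S \subset J) && `[< inf_witnessed S >]) S.

Lemma inf_core_witnessed J : inf_witnessed (inf_core J).
Proof.
apply: big_ind => [|S T|S /andP[_ /asboolP]//]; first exact: inf_witnessed0.
exact: inf_witnessedU.
Qed.

Lemma inf_core_sub J : inf_core J \subset J.
Proof. by apply/finset.bigcupsP => S /andP[]. Qed.

Lemma inf_core_max J S : S \subset J -> inf_witnessed S -> S \subset inf_core J.
Proof. by move=> SJ Sw; apply: finset.bigcup_sup; rewrite SJ; apply/asboolP. Qed.

(** Anything in J linked to the core could be added to it. *)
Lemma inf_core_perp J : J :\: inf_core J \subset perp A (inf_core J).
Proof.
apply/fintype.subsetP => k; rewrite inE => /andP[kM kJ]; apply: contraNT (kM) => kP.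
have := inf_witnessed_add (inf_core_witnessed J) kM kP.
move/inf_core_max => /(_ J); rewrite finset.subUset finset.sub1set kJ inf_core_sub.
by move=> /(_ isT); rewrite finset.subUset finset.sub1set => /andP[].
Qed.

Lemma inf_core_fin J : fin_witnessed (J :\: inf_core J).
Proof.
have [[S [SJ /finset.set0Pn[i iS] Sw]]|//] :=
  inf_or_fin_witnessed (J :\: inf_core J).
have := fintype.subsetP SJ i iS; rewrite inE => /andP[/negP[]].
apply: fintype.subsetP i iS; apply: inf_core_max => //.
exact: fintype.subset_trans SJ (finset.subsetDl _ _).
Qed.

Section Symmetrized.
Variable d : I -> R.
Hypothesis d_gt0 : forall i, 0 < d i.
Hypothesis d_sym : forall i j, d i * a i j = d j * a j i.

Lemma cartan_mul_adj c e :
  \sum_i d i * (c i * cartan_mul e i) = \sum_i d i * (e i * cartan_mul c i).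
Proof.
under eq_bigr do rewrite /cartan_mul !mulr_sumr.
rewrite exchange_big /=; apply: eq_bigr => i _; rewrite /cartan_mul !mulr_sumr.
apply: eq_bigr => j _.
transitivity (d j * a j i * (c j * e i)); first by ring.
by rewrite d_sym; ring.
Qed.

(** Pairing the two witnesses through the symmetrized matrix gives a sum that
    is both positive and nonpositive. *)
Lemma fin_inf_disjoint K S :
  fin_witnessed K -> inf_witnessed S -> S \subset K -> S = finset.set0.
Proof.
move=> [u [u0 u1 u2]] [c [c0 c1 c2]] SK; apply/eqP; rewrite -finset.subset0.
apply/fintype.subsetP => k kS.
have c3 := witness_ge0 c0 c1; have u3 := witness_ge0 u0 u1.
have : 0 < \sum_i d i * (c i * cartan_mul u i).
  rewrite (bigD1 k) //= ltr_pwDl //.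
    by rewrite !mulr_gt0 ?d_gt0 ?c0 ?u2 // (fintype.subsetP SK).
  apply: sumr_ge0 => i _; have [iS|/c1 ->] := boolP (i \in S).
    by rewrite !mulr_ge0 ?ltW ?d_gt0 ?c0 ?u2 // (fintype.subsetP SK).
  by rewrite mul0r mulr0.
rewrite cartan_mul_adj ltNge => /negP[]; apply: sumr_le0 => i _.
apply: mulr_ge0_le0; first exact: ltW.
apply: mulr_ge0_le0 => //.
by have [/c2|/c1/(cartan_mul_off_le0 c3)] := boolP (i \in S).
Qed.

Lemma inf_witnessed_restrict K S :
  (forall i j, i \in S :&: K -> j \in S :\: K -> A i j = 0) ->
  inf_witnessed S -> inf_witnessed (S :&: K).
Proof.
move=> orth [c [c0 c1 c2]]; exists (fun i => if i \in K then c i else 0).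
split=> i; rewrite inE.
- by case/andP=> /c0 + ->.
- by rewrite negb_and; case: ifP => //; rewrite orbF => _ /c1.
- move=> iSK; have /andP[/c2 ci _] := iSK; apply: le_trans ci.
  apply: ler_sum => j _; case: ifP => // /negbT jK; rewrite mulr0.
  have [jS|/c1 ->] := boolP (j \in S); last by rewrite mulr0.
  by rewrite orth ?mul0r // !inE ?iSK // jK.
Qed.

(** At an index where v / u is smallest and negative, v minus that multiple of
    u is nonnegative and vanishes, so its image there cannot be positive. *)
Lemma fin_witnessed_monotone K v :
  fin_witnessed K -> (forall i, i \notin K -> v i = 0) ->
  (forall i, i \in K -> 0 <= cartan_mul v i) -> forall i, 0 <= v i.
Proof.
move=> [u [u0 u1 u2]] vK vle i; have [iK|/vK ->//] := boolP (i \in K).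
rewrite leNgt; apply/negP => vi.
case: (arg_minP (fun j => v j / u j) iK) => j jK jmin.
pose m := v j / u j.
have m0 : m < 0.
  apply: le_lt_trans (jmin i iK) _.
  by rewrite pmulr_llt0 // invr_gt0 u0.
pose x k := v k + (- m) * u k.
have x0 k : 0 <= x k.
  rewrite /x mulNr subr_ge0.
  have [kK|kK] := boolP (k \in K); last by rewrite vK // u1 // mulr0.
  by rewrite -ler_pdivlMr ?u0 // jmin.
have : cartan_mul x j <= 0.
  apply: cartan_mul_off_le0 => //.
  by rewrite /x /m mulNr divfK ?subrr // gt_eqF ?u0.
rewrite cartan_mulD cartan_mulZ leNgt => /negP[].
by rewrite ltr_wpDl ?vle // mulr_gt0 ?u2 // oppr_gt0.
Qed.

(** In the coordinates y = x / u the difference of the two sides is half the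
    sum of the d_i a_ij u_i u_j (y_i - y_j)^2, in which only off-diagonal
    entries count. With A u positive on K this makes the form positive
    definite there. *)
Lemma quadratic_form_ge K u x :
  (forall i, i \in K -> 0 < u i) -> (forall i, i \notin K -> u i = 0) ->
  (forall i, i \notin K -> x i = 0) ->
  \sum_i d i * (x i * (x i * (cartan_mul u i / u i)))
    <= \sum_i d i * (x i * cartan_mul x i).
Proof.
move=> u0 u1 x1; have u3 := witness_ge0 u0 u1.
pose y i := x i / u i.
have xE i : x i = u i * y i.
  have [iK|iK] := boolP (i \in K); last by rewrite x1 // u1 // mul0r.
  by rewrite /y mulrCA divff ?mulr1 // gt_eqF ?u0.
pose b i j := d i * a i j * u i * u j.
have bC i j : b i j = b j i by rewrite /b d_sym; ring.
have LE : \sum_i d i * (x i * (x i * (cartan_mul u i / u i)))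
        = \sum_i \sum_j b i j * (y i * y i).
  apply: eq_bigr => i _; rewrite /cartan_mul mulr_suml !mulr_sumr.
  apply: eq_bigr => j _; rewrite /b xE.
  have [iK|iK] := boolP (i \in K); last by rewrite u1 //; ring.
  by field; rewrite gt_eqF ?u0.
have RE : \sum_i d i * (x i * cartan_mul x i) = \sum_i \sum_j b i j * (y i * y j).
  apply: eq_bigr => i _; rewrite /cartan_mul !mulr_sumr.
  by apply: eq_bigr => j _; rewrite /b !xE; ring.
have LE' : \sum_i \sum_j b i j * (y i * y i) = \sum_i \sum_j b i j * (y j * y j).
  by rewrite exchange_big; apply: eq_bigr => i _; apply: eq_bigr => j _; rewrite bC.
have : \sum_i \sum_j b i j * (y i - y j) ^+ 2 <= 0.
  apply: sumr_le0 => i _; apply: sumr_le0 => j _.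
  have [->|ij] := eqVneq i j; first by rewrite subrr expr0n mulr0.
  rewrite mulr_le0_ge0 ?sqr_ge0 // /b 2?mulr_le0_ge0 //.
  by rewrite mulr_ge0_le0 ?gcm_off // ltW.
have -> : \sum_i \sum_j b i j * (y i - y j) ^+ 2 =
    (\sum_i \sum_j b i j * (y i * y i) + \sum_i \sum_j b i j * (y j * y j))
    - (\sum_i \sum_j b i j * (y i * y j) + \sum_i \sum_j b i j * (y i * y j)).
  rewrite -!big_split -sumrB /=; apply: eq_bigr => i _.
  rewrite -!big_split -sumrB /=; apply: eq_bigr => j _.
  ring.
by rewrite -LE' LE RE; lra.
Qed.

(** This is what makes the root system of a set of finite type finite: its
    positive roots are integral and have bounded norm. *)
Lemma integer_vectors_bounded K (C : R) : fin_witnessed K ->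
  exists N : nat, forall n : I -> int,
    (forall i, 0 <= n i) -> (forall i, i \notin K -> n i = 0) ->
    \sum_i d i * ((n i)%:~R * cartan_mul (fun j => (n j)%:~R) i) <= C ->
    forall i, n i <= N%:Z.
Proof.
move=> [u [u0 u1 u2]].
pose e i := d i * (cartan_mul u i / u i).
have e0 i : i \in K -> 0 < e i.
  by move=> iK; rewrite mulr_gt0 ?divr_gt0 ?u0 ?u2.
exists (Num.bound (\sum_(i in K) `|C| / e i)) => n n0 nK nC i.
have [iK|/nK ->] := boolP (i \in K); last by [].
rewrite -(ler_int R) -pmulrn.
apply: le_trans (ltW (archi_boundP _)); last first.
  by apply: sumr_ge0 => j jK; rewrite divr_ge0 // ltW ?e0.
apply: (@le_trans _ _ (`|C| / e i)); last first.
  rewrite (bigD1 i) //= lerDl; apply: sumr_ge0 => j /andP[jK _].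
  by rewrite divr_ge0 // ltW ?e0.
rewrite ler_pdivlMr ?e0 //; apply: le_trans (ler_norm _).
apply: le_trans nC; apply: le_trans (quadratic_form_ge u0 u1 _); last first.
  by move=> j /nK ->.
rewrite (bigD1 i) //= -[leLHS]addr0; apply: lerD; last first.
  apply: sumr_ge0 => j _; have [jK|jK] := boolP (j \in K).
    by rewrite !mulr_ge0 ?ler0z ?n0 ?invr_ge0 // ltW // ?u0 ?u2.
  by rewrite nK // mul0r mulr0.
(* A natural number is at most its square. *)
rewrite mulrC /e [leRHS](_ : _ = e i * ((n i)%:~R * (n i)%:~R)); last first.
  by rewrite /e; ring.
rewrite -/(e i) ler_pM2l ?e0 // -intrM ler_int.
by have := n0 i; nia.
Qed.

Lemma cartan_mul_enum K c (p : 'I_#|K|) : (forall i, i \notin K -> c i = 0) ->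
  cartan_mul c (enum_val p) =
  (principal_submx R A K *m \col_q c (enum_val q)) p 0.
Proof.
move=> cK; rewrite mxE /cartan_mul (bigID [in K]) /= [X in _ + X]big1 ?addr0.
  by rewrite big_enum_val; apply: eq_bigr => q _; rewrite !mxE.
by move=> i iK; rewrite cK ?mulr0.
Qed.

Lemma col_extension K (v : 'cV[R]_#|K|) :
  exists2 c, forall i, i \notin K -> c i = 0 & v = \col_q c (enum_val q).
Proof.
exists (fun i => \sum_q (enum_val q == i)%:R * v q 0) => [i iK|].
  apply: big1 => q _; case: eqP => [qi|_]; last by rewrite mul0r.
  by rewrite -qi enum_valP in iK.
apply/colP => p; rewrite mxE (bigD1 p) //= eqxx mul1r big1 ?addr0 // => q qp.
by rewrite (inj_eq enum_val_inj) (negPf qp) mul0r.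
Qed.

Lemma finite_type_witnessed K :
  finite_type (principal_submx R A K) -> fin_witnessed K.
Proof.
case=> _ [v [v0 Bv0]] _; have [c c1 vE] := col_extension v.
exists c; split=> // i iK; rewrite -(enum_rankK_in iK iK).
  by have := v0 (enum_rank_in iK i); rewrite vE mxE.
by rewrite cartan_mul_enum // -vE.
Qed.

(** Connectedness enters only in the last clause of finite type: the zeros of
    a nonnegative v with nonnegative image form a set linked to nothing else. *)
Lemma witnessed_finite_type K :
  (forall M, M \subset K -> M != finset.set0 ->
     K :\: M \subset perp A M -> M = K) ->
  fin_witnessed K -> finite_type (principal_submx R A K).
Proof.
move=> connK Kfin; have [u [u0 u1 u2]] := Kfin.
have mono (v : 'cV[R]_#|K|) :
    (forall p, 0 <= (principal_submx R A K *m v) p 0) -> forall p, 0 <= v p 0.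
  have [c c1 ->] := col_extension v => Bv p; rewrite mxE.
  apply: (fin_witnessed_monotone Kfin c1) => i iK.
  by rewrite -(enum_rankK_in iK iK) cartan_mul_enum.
split.
- rewrite -det_tr; apply/negP => /det0P[v vn0 Bv].
  have {}Bv : principal_submx R A K *m v^T = 0.
    by apply: trmx_inj; rewrite trmx_mul trmxK Bv trmx0.
  case/eqP: vn0; apply/rowP => p; apply/eqP; rewrite eq_le mxE -oppr_ge0.
  have v1 := mono v^T; have v2 := mono (- v^T).
  move: (v1) (v2); rewrite mulmxN Bv oppr0.
  have z0 p' : 0 <= (0 : 'cV[R]_#|K|) p' 0 by rewrite mxE.
  by move=> /(_ z0 p) + /(_ z0 p); rewrite !mxE oppr_ge0 => -> ->.
- exists (\col_q u (enum_val q)); split=> p; first by rewrite mxE u0 // enum_valP.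
  by rewrite -cartan_mul_enum ?u2 ?enum_valP.
- move=> v Bv; have v0 := mono v Bv; have [c c1 vE] := col_extension v.
  have c0 i : 0 <= c i.
    have [iK|/c1 -> //] := boolP (i \in K).
    by have := v0 (enum_rank_in iK i); rewrite vE mxE enum_rankK_in.
  pose M := [set i in K | c i == 0]%SET.
  have [M0|Mn0] := eqVneq M finset.set0.
    left=> p; rewrite lt_neqAle v0 andbT vE mxE eq_sym; apply/eqP => cp.
    suff : enum_val p \in M by rewrite M0 inE.
    by rewrite inE enum_valP cp eqxx.
  right; have MK : M = K.
    apply: connK => //; first by apply/fintype.subsetP => i; rewrite inE => /andP[].
    apply/fintype.subsetP => k; rewrite !inE negb_and => /andP[+ kK].
    rewrite kK /= => ck; apply/forall_inP => j; rewrite inE => /andP[jK /eqP cj].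
    have jk : j != k by apply: contraNneq ck => <-; rewrite cj.
    have : 0 <= cartan_mul c j.
      by rewrite -(enum_rankK_in jK jK) cartan_mul_enum // -vE.
    apply: contraTT => akj; rewrite -ltNge /cartan_mul (bigD1 k) //= -[ltRHS]addr0.
    apply: ltr_leD.
      rewrite nmulr_rlt0 ?lt_neqAle ?gcm_off // ?intr_eq0 ?(gcm_sym0 j) ?akj //.
      by rewrite c0 eq_sym ck.
    apply: sumr_le0 => i _; have [->|ij] := eqVneq i j; first by rewrite cj mulr0.
    by rewrite mulr_le0_ge0 // gcm_off // eq_sym.
  apply/colP => p; rewrite vE !mxE.
  by have := enum_valP p; rewrite -{2}MK inE => /andP[_ /eqP].
Qed.

Lemma dynkin_connect_sym J : connect_sym (dynkin_edge A J).
Proof.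
apply: sym_connect_sym => i j; rewrite /dynkin_edge gcm_sym0.
by rewrite andbCA.
Qed.

Lemma dynkin_component_sub J K : K \in dynkin_components A J -> K \subset J.
Proof.
case/imsetP=> i iJ ->; apply/fintype.subsetP => j; rewrite inE => ij.
rewrite -(closed_connect _ ij) // => x y; rewrite /dynkin_edge.
by case/and3P=> -> ->.
Qed.

Lemma dynkin_component_orth J K i j : K \in dynkin_components A J ->
  i \in K -> j \in J :\: K -> A i j = 0.
Proof.
move=> KJ iK; rewrite inE => /andP[jK jJ].
have iJ := fintype.subsetP (dynkin_component_sub KJ) i iK.
case/imsetP: KJ => k kJ KE; apply/eqP; apply: contraNT jK => aij.
move: iK; rewrite KE !inE => /connect_trans; apply; apply: connect1.
by rewrite /dynkin_edge iJ jJ.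
Qed.

Lemma dynkin_component_conn J K M : K \in dynkin_components A J ->
  M \subset K -> M != finset.set0 -> K :\: M \subset perp A M -> M = K.
Proof.
move=> KJ MK /finset.set0Pn[m mM] orth; apply/eqP; rewrite finset.eqEsubset MK /=.
have KJs := dynkin_component_sub KJ.
case/imsetP: (KJ) => k kJ KE; apply/fintype.subsetP => x xK.
have mK := fintype.subsetP MK m mM.
have cmx : connect (dynkin_edge A J) m x.
  apply: (@connect_trans _ _ k).
    by rewrite dynkin_connect_sym; move: mK; rewrite KE inE.
  by move: xK; rewrite KE inE.
rewrite -(closed_connect _ cmx) //; apply: intro_closed.
  exact: dynkin_connect_sym.
move=> y z /and3P[yJ zJ ayz] yM; apply: contraT => zM.
have zK : z \in K.
  apply: contraNT ayz => zK; apply/eqP/(dynkin_component_orth KJ).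
    exact: fintype.subsetP MK _ yM.
  by rewrite inE zK.
have := fintype.subsetP orth z; rewrite inE zM zK => /(_ isT).
by rewrite inE => /forall_inP/(_ y yM); rewrite gcm_sym0 (negPf ayz).
Qed.

(** A component that is not of finite type contains a nonempty witnessed set
    by the theorem of the alternative, hence is witnessed itself by
    connectedness. Conversely the core meets each component in a witnessed
    set, which is empty if the component is of finite type. *)
Lemma infty_part_core J : infty_part R A J = inf_core J.
Proof.
apply/eqP; rewrite finset.eqEsubset; apply/andP; split.
  apply/finset.bigcupsP => K; rewrite inE => /andP[KJ Kinf].
  apply: inf_core_max; first exact: dynkin_component_sub KJ.
  have [MK|M0] := eqVneq (inf_core K) finset.set0.
    case/negP: Kinf; apply/asboolP/witnessed_finite_type.
      by move=> M; apply: dynkin_component_conn KJ.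
    by rewrite -[X in fin_witnessed X]finset.setD0 -MK; apply: inf_core_fin.
  rewrite -(dynkin_component_conn KJ (inf_core_sub K) M0 (inf_core_perp K)).
  exact: inf_core_witnessed.
apply/fintype.subsetP => i iM; have iJ := fintype.subsetP (inf_core_sub J) i iM.
pose K := [set j in connect (dynkin_edge A J) i]%SET.
have KJ : K \in dynkin_components A J by apply/imsetP; exists i.
have iK : i \in K by rewrite inE; apply: connect0.
apply/finset.bigcupP; exists K => //; rewrite inE KJ /=.
apply/asboolPn => /finite_type_witnessed Kfin.
have : inf_core J :&: K = finset.set0.
  apply: fin_inf_disjoint Kfin _ (finset.subsetIr _ _).
  apply: inf_witnessed_restrict (inf_core_witnessed J) => x y.
  rewrite finset.in_setI finset.in_setD => /andP[_ xK] /andP[yK yM].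
  apply: (dynkin_component_orth KJ xK).
  by rewrite finset.in_setD yK (fintype.subsetP (inf_core_sub J)).
by move/finset.setP/(_ i); rewrite finset.in_setI finset.in_set0 iM iK.
Qed.

Lemma special_witnessed J : special R A J <-> inf_witnessed J.
Proof.
rewrite /special infty_part_core; split=> [->|Jw]; first exact: inf_core_witnessed.
by apply/eqP; rewrite finset.eqEsubset inf_core_sub inf_core_max.
Qed.

End Symmetrized.
End CartanMatrix.
(** * The root lattice *)

Section RootAction.
Variables (I : finType) (A : I -> I -> int).
Hypothesis A_gcm : gen_cartan_mx A.
Implicit Types (i j k : I) (n m : {ffun I -> int}) (s t : seq I).

(** Elements of the root lattice are given by their integer coordinates in the
    basis of simple roots; integrality of the coordinates is essential below. *)
Definition simple_root i : {ffun I -> int} := [ffun k => (k == i)%:Z].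

Definition root_refl j n : {ffun I -> int} :=
  [ffun k => n k - (k == j)%:Z * \sum_l A j l * n l].

Definition root_act s n := foldr root_refl n s.

Definition comb (p q : int) n m : {ffun I -> int} :=
  [ffun k => p * n k + q * m k].

Lemma root_refl_comb j p q n m :
  root_refl j (comb p q n m) = comb p q (root_refl j n) (root_refl j m).
Proof.
apply/ffunP => k; rewrite !ffunE.
have -> : \sum_l A j l * comb p q n m l =
          p * (\sum_l A j l * n l) + q * (\sum_l A j l * m l).
  rewrite !mulr_sumr -big_split; apply: eq_bigr => l _ /=; rewrite ffunE.
  ring.
ring.
Qed.

Lemma root_act_comb s p q n m :
  root_act s (comb p q n m) = comb p q (root_act s n) (root_act s m).
Proof. by elim: s => //= j s ->; rewrite root_refl_comb. Qed.

Lemma cartan_sum_simple j i : \sum_l A j l * simple_root i l = A j i.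
Proof.
rewrite (bigD1 i) //= ffunE eqxx mulr1 big1 ?addr0 // => l /negPf li.
by rewrite ffunE li mulr0.
Qed.

Lemma root_reflK j : involutive (root_refl j).
Proof.
move=> n; apply/ffunP => k; rewrite !ffunE.
have -> : \sum_l A j l * root_refl j n l = - \sum_l A j l * n l.
  transitivity (\sum_l A j l * n l -
      \sum_l A j l * ((l == j)%:Z * \sum_m A j m * n m)).
    by rewrite -sumrB; apply: eq_bigr => l _; rewrite ffunE mulrBr.
  rewrite [X in _ - X](bigD1 j) //= eqxx [X in _ - (_ + X)]big1.
    case: A_gcm => -> _ _ /=. ring.
  by move=> l /negPf ->; rewrite mul0r mulr0.
by case: eqP => _; ring.
Qed.

Lemma root_refl_simple j :
  root_refl j (simple_root j) = comb (-1) 0 (simple_root j) (simple_root j).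
Proof.
apply/ffunP => k; rewrite ffunE cartan_sum_simple; case: A_gcm => -> _ _.
by rewrite !ffunE; case: eqP => _; ring.
Qed.

Lemma root_act_cat s t n : root_act (s ++ t) n = root_act s (root_act t n).
Proof. by rewrite /root_act foldr_cat. Qed.

Lemma root_act_rcons s i n : root_act (rcons s i) n = root_act s (root_refl i n).
Proof. by rewrite -cats1 root_act_cat. Qed.

Lemma root_actK s : cancel (root_act s) (root_act (rev s)).
Proof.
by elim: s => //= i s IH n; rewrite rev_cons root_act_rcons root_reflK IH.
Qed.

Lemma root_act_revK s : cancel (root_act (rev s)) (root_act s).
Proof. by move=> n; rewrite -[X in root_act X]revK root_actK. Qed.

Definition nonneg n := forall k, 0 <= n k.
Definition nonpos n := forall k, n k <= 0.

Definition sign_coherent n := nonneg n \/ nonpos n.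

Lemma root_act_support (J : {set I}) s n : all (mem J) s ->
  (forall k, k \notin J -> n k = 0) -> forall k, k \notin J -> root_act s n k = 0.
Proof.
elim: s => //= j s IH /andP[jJ sJ] nJ k kJ; rewrite ffunE IH //.
by rewrite (_ : k == j = false) ?mul0r //; apply: contraNF kJ => /eqP ->.
Qed.

(** The form b p^2 - a b p q + a q^2 is invariant under both reflections, and
    its value b at (1, 0) cannot be reached with p, q integers of opposite
    signs. *)
Lemma rank2_sign_coherent i j d : i != j -> all (mem [set i; j]%SET) d ->
  exists p q, root_act d (simple_root i) = comb p q (simple_root i) (simple_root j)
    /\ (0 <= p /\ 0 <= q \/ p <= 0 /\ q <= 0).
Proof.
move=> ij dij; pose a := - A i j; pose b := - A j i.
have [A2 An A0] := A_gcm.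
have a0 : 0 <= a by rewrite oppr_ge0 An.
have b0 : 0 <= b by rewrite oppr_ge0 An // eq_sym.
have ab : (a == 0) = (b == 0).
  by rewrite !oppr_eq0; apply/eqP/eqP => /A0.
have sumE k p q : \sum_l A k l * comb p q (simple_root i) (simple_root j) l =
    p * A k i + q * A k j.
  rewrite -!cartan_sum_simple !mulr_sumr -big_split; apply: eq_bigr => l _ /=.
  rewrite ffunE; ring.
have [p [q [-> Qpq aq]]] : exists p q,
    [/\ root_act d (simple_root i) = comb p q (simple_root i) (simple_root j),
        b * (p * p) - a * b * (p * q) + a * (q * q) = b & a = 0 -> q = 0].
  elim: d dij => [_|k d IH /= /andP[kij /IH[p [q [-> Qpq aq]]]]].
    exists 1, 0; split=> //; last by ring.
    by apply/ffunP => l; rewrite !ffunE; ring.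
  move: kij; rewrite !inE => /orP[] /eqP ->.
    exists (- p + a * q), q; split=> //; last by rewrite -[RHS]Qpq; ring.
    apply/ffunP => l; rewrite !ffunE sumE A2 /a.
    by case: eqP => _; ring.
  exists p, (b * p - q); split=> //.
  - apply/ffunP => l; rewrite !ffunE sumE A2 /b.
    by case: eqP => _; ring.
  - by rewrite -[RHS]Qpq; ring.
  - move=> a00; rewrite aq // subr0; move/eqP: a00; rewrite ab => /eqP ->.
    by rewrite mul0r.
exists p, q; split=> //.
have [a00|an0] := eqVneq a 0; first by rewrite aq //; lia.
have bn0 : b != 0 by rewrite -ab.
have {}a0 : 0 < a by rewrite lt_neqAle eq_sym an0.
have {}b0 : 0 < b by rewrite lt_neqAle eq_sym bn0.
have key x y : 0 < x -> y < 0 -> b < b * (x * x) - a * b * (x * y) + a * (y * y).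
  move=> x0 y0; have y2 : 0 < a * (y * y) by rewrite mulr_gt0 // nmulr_rgt0.
  have xy : a * b * (x * y) < 0 by rewrite pmulr_rlt0 ?mulr_gt0 // pmulr_rlt0.
  have : b <= b * (x * x) by rewrite ler_pMr // mulr_ege1 //; lia.
  lia.
have [p0|p0] := leP 0 p; have [q0|q0] := leP 0 q;
  [by left| | |by right; split; apply: ltW].
  have [->|pn0] := eqVneq p 0; first by right; split=> //; lia.
  have p1 : 0 < p by rewrite lt_neqAle eq_sym pn0.
  by have := key p q p1 q0; rewrite Qpq ltxx.
have [->|qn0] := eqVneq q 0; first by right; split=> //; lia.
have q1 : 0 < q by rewrite lt_neqAle eq_sym qn0.
have := key (- p) (- q); rewrite oppr_gt0 oppr_lt0 => /(_ p0 q1).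
rewrite [ltRHS](_ : _ = b) ?ltxx // -[RHS]Qpq; ring.
Qed.

End RootAction.
Section WeylGroup.
Variables (R : realType) (I : finType) (A : I -> I -> int).
Hypothesis A_gcm : gen_cartan_mx A.
Variable d : I -> R.
Hypothesis d_gt0 : forall i, 0 < d i.
Hypothesis d_sym : forall i j, d i * (A i j)%:~R = d j * (A j i)%:~R.
Variables (h : vectType R) (D : minimal_realization A h).

Local Notation V := 'Hom(h, R^o).
Local Notation a i j := ((A i j)%:~R : R).
Local Notation alpha i := (Defs.root D i).
Local Notation W := (word_prod D).
Local Notation S := (simple_refl D).
Local Notation ract := (root_act A).
Local Notation sroot := (@simple_root I).
Implicit Types (i j k : I) (J K T : {set I}) (s t : seq I) (l m x y z : V).

(** * Words acting on weights *)

Definition coval l i : R := l (coroot D i).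

Lemma covalD l m i : coval (l + m) i = coval l i + coval m i.
Proof. by rewrite /coval add_lfunE. Qed.

Lemma covalZ (c : R) l i : coval (c *: l) i = c * coval l i.
Proof. by rewrite /coval scale_lfunE. Qed.

Lemma covalB l m i : coval (l - m) i = coval l i - coval m i.
Proof. by rewrite -scaleN1r covalD covalZ mulN1r. Qed.

Lemma coval_root i j : coval (alpha j) i = a i j.
Proof. exact: root_coroot. Qed.

Lemma coval_sum (F : I -> V) i : coval (\sum_k F k) i = \sum_k coval (F k) i.
Proof. by rewrite /coval sum_lfunE. Qed.

Lemma simple_refl_coval i l : S i l = l - coval l i *: alpha i.
Proof. exact: simple_reflE. Qed.

Lemma coval_refl i j l : coval (S j l) i = coval l i - coval l j * a i j.
Proof. by rewrite simple_refl_coval covalB covalZ coval_root. Qed.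

Lemma coval_refl_diag j l : coval (S j l) j = - coval l j.
Proof. by rewrite coval_refl gcm_diag //; ring. Qed.

Lemma simple_refl_fix i l : coval l i = 0 -> S i l = l.
Proof. by rewrite simple_refl_coval => ->; rewrite scale0r subr0. Qed.

Lemma simple_reflK i : involutive (S i).
Proof.
move=> l; rewrite simple_refl_coval coval_refl_diag simple_refl_coval.
by rewrite scaleNr opprK subrK.
Qed.

Lemma word_cons i s l : W (i :: s) l = S i (W s l).
Proof. exact: comp_lfunE. Qed.

Lemma word_nil l : W [::] l = l.
Proof. exact: id_lfunE. Qed.

Lemma word_cat s t l : W (s ++ t) l = W s (W t l).
Proof. by elim: s => [|i s IH] /=; rewrite ?word_nil // !word_cons IH. Qed.

Lemma word_rcons s i l : W (rcons s i) l = W s (S i l).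
Proof. by rewrite -cats1 word_cat word_cons word_nil. Qed.

Lemma word_cat_comp s t : W (s ++ t) = (W s \o W t)%VF.
Proof. by apply/lfunP => l; rewrite comp_lfunE word_cat. Qed.

Lemma wordK s : cancel (W s) (W (rev s)).
Proof.
elim: s => [|i s IH] l /=; first by rewrite !word_nil.
by rewrite rev_cons word_rcons word_cons simple_reflK IH.
Qed.

Lemma word_revK s : cancel (W (rev s)) (W s).
Proof. by move=> l; rewrite -[X in W X]revK wordK. Qed.

Lemma word_rev_eq s t : W s = W t -> W (rev s) = W (rev t).
Proof.
move=> st; apply/lfunP => l; apply: (can_inj (wordK s)).
by rewrite word_revK st word_revK.
Qed.

Lemma word_inv s : (W s)^-1%VF = W (rev s).
Proof.
have ker0 : lker (W s) == 0%VS.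
  by apply/lker0P; apply: can_inj (wordK s).
by apply/lfunP => l; apply: (can_inj (wordK s)); rewrite lker0_lfunVK // word_revK.
Qed.

Lemma word_fix s l : (forall i, i \in s -> coval l i = 0) -> W s l = l.
Proof.
elim: s => [|i s IH] ls; first exact: word_nil.
rewrite word_cons IH => [|j js]; last by rewrite ls // inE js orbT.
by rewrite simple_refl_fix // ls // inE eqxx.
Qed.

Lemma coval_word_orth T s l i : all (mem (perp A T)) s -> i \in T ->
  coval (W s l) i = coval l i.
Proof.
move=> + iT; elim: s => [|j s IH] /=; first by rewrite word_nil.
case/andP; rewrite inE => /forall_inP/(_ i iT) aji /IH Wl.
move: aji; rewrite (gcm_sym0 A_gcm) => /eqP aij.
by rewrite word_cons coval_refl aij mulr0 subr0.
Qed.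

Definition rcomb (c : I -> R) : V := \sum_k c k *: alpha k.

(** Freeness of a family indexed by a finite type, in place of a sequence. *)
Lemma free_image_eq0 (U : vectType R) (f : I -> U) (c : I -> R) :
  free [seq f i | i : I] -> \sum_k c k *: f k = 0 -> forall k, c k = 0.
Proof.
move=> /(@freeP _ _ _ (in_tuple [seq f i | i : I])) fP c0 k.
have sz : size [seq f i | i : I] = #|I| by rewrite size_image.
pose cst (p : 'I_(size [seq f i | i : I])) := c (enum_val (cast_ord sz p)).
have /fP/(_ (cast_ord (esym sz) (enum_rank k))) :
    \sum_p cst p *: (in_tuple [seq f i | i : I])`_p = 0.
  rewrite -[RHS]c0 (reindex (fun k => cast_ord (esym sz) (enum_rank k))) /=.
    apply: eq_bigr => j _; rewrite /cst cast_ordKV enum_rankK.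
    by rewrite (nth_map j) ?nth_enum_rank // -cardE ltn_ord.
  exists (fun p => enum_val (cast_ord sz p)) => p _.
    by rewrite cast_ordKV enum_rankK.
  by rewrite enum_valK cast_ordK.
by rewrite /cst cast_ordKV enum_rankK.
Qed.

Lemma rcomb_eq0 c : rcomb c = 0 -> forall k, c k = 0.
Proof. exact: free_image_eq0 (free_root D). Qed.

Lemma rcombB c e : rcomb c - rcomb e = rcomb (fun k => c k - e k).
Proof. by rewrite -sumrB; apply: eq_bigr => k _; rewrite scalerBl. Qed.

Lemma rcomb_inj c e : rcomb c = rcomb e -> forall k, c k = e k.
Proof.
move/eqP; rewrite -subr_eq0 rcombB => /eqP/rcomb_eq0 ce k.
by apply/eqP; rewrite -subr_eq0 ce.
Qed.

(** The coroots are linearly independent, so their values can be prescribed. *)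
Lemma weight_exists (v : I -> R) : exists l : V, forall i, coval l i = v i.
Proof.
pose X := in_tuple [seq coroot D i | i : I].
have fX : free X by exact: free_coroot.
have sz : size [seq coroot D i | i : I] = #|I| by rewrite size_image.
pose g p : V := v (enum_val (cast_ord sz p)) *: linfun (coord X p : h -> R^o).
exists (\sum_p g p) => i; rewrite /coval sum_lfunE.
pose q := cast_ord (esym sz) (enum_rank i).
have coordE p : coord X p (coroot D i) = (p == q)%:R.
  rewrite eq_sym -(coord_free q p fX); congr (coord X p _).
  by rewrite /= (nth_map i) ?nth_enum_rank // -cardE ltn_ord.
rewrite (bigD1 q) // scale_lfunE lfunE /= coordE eqxx cast_ordKV enum_rankK.
rewrite big1 ?addr0 => [|p pq]; first exact: mulr1.
by rewrite scale_lfunE lfunE /= coordE (negPf pq) scaler0.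
Qed.


(** * Roots and the deletion property *)

Definition intR (n : {ffun I -> int}) : I -> R := fun k => (n k)%:~R.

Lemma intR_inj n n' : (forall k, intR n k = intR n' k) -> n = n'.
Proof. by move=> nm; apply/ffunP => k; apply: (@intr_inj R); apply: nm. Qed.

Lemma refl_rcomb j n : S j (rcomb (intR n)) = rcomb (intR (root_refl A j n)).
Proof.
have -> : rcomb (intR (root_refl A j n)) =
    rcomb (intR n) - rcomb (fun k => (k == j)%:R * \sum_l a j l * (n l)%:~R).
  rewrite rcombB; apply: eq_bigr => k _; congr (_ *: _).
  rewrite /intR ffunE intrB intrM pmulrn; congr (_ - _ * _).
  by rewrite rmorph_sum; apply: eq_bigr => l _; rewrite /= intrM.
rewrite simple_refl_coval; congr (_ - _).
rewrite /rcomb [RHS](bigD1 j) //= eqxx mul1r [X in _ + X]big1 ?addr0.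
  rewrite coval_sum; congr (_ *: _); apply: eq_bigr => k _.
  by rewrite covalZ coval_root mulrC.
by move=> k /negPf ->; rewrite mul0r scale0r.
Qed.

Lemma word_rcomb s n : W s (rcomb (intR n)) = rcomb (intR (ract s n)).
Proof.
by elim: s => [|j s IH]; rewrite ?word_nil // word_cons IH refl_rcomb.
Qed.

Lemma alphaE i : alpha i = rcomb (intR (sroot i)).
Proof.
rewrite /rcomb (bigD1 i) //= /intR ffunE eqxx scale1r big1 ?addr0 //.
by move=> k /negPf ki; rewrite ffunE ki scale0r.
Qed.

Lemma word_alpha s i : W s (alpha i) = rcomb (intR (ract s (sroot i))).
Proof. by rewrite alphaE word_rcomb. Qed.

Lemma word_eq_root_act s t n : W s = W t -> ract s n = ract t n.
Proof.
move=> st; apply: intR_inj; apply: rcomb_inj.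
by rewrite -!word_rcomb st.
Qed.

(** The functional sum_k c_k d_k h_k, which corresponds to the element of the
    root lattice with coordinates c under the invariant form defined by d. For
    the coordinates of a root it is a positive multiple of the coroot, so that
    coroots need no action of their own. *)
Definition copair (c : I -> R) l : R := \sum_k c k * (d k * coval l k).

Lemma copair_simple i l : copair (intR (sroot i)) l = d i * coval l i.
Proof.
rewrite /copair (bigD1 i) //= /intR ffunE eqxx mul1r big1 ?addr0 //.
by move=> k /negPf ki; rewrite ffunE ki mul0r.
Qed.

Lemma copair_lin c (p q : R) l m :
  copair c (p *: l + q *: m) = p * copair c l + q * copair c m.
Proof.
rewrite /copair !mulr_sumr -big_split; apply: eq_bigr => k _ /=.
by rewrite covalD !covalZ; ring.
Qed.

Lemma copair_refl j n l :
  copair (intR n) (S j l) = copair (intR (root_refl A j n)) l.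
Proof.
transitivity (copair (intR n) l
              - d j * coval l j * \sum_k a j k * (n k)%:~R).
  rewrite /copair mulr_sumr -sumrB; apply: eq_bigr => k _.
  rewrite coval_refl /intR.
  have -> : d j * coval l j * (a j k * (n k)%:~R) =
    coval l j * (n k)%:~R * (d j * a j k) by ring.
  by rewrite d_sym; ring.
transitivity (copair (intR n) l -
    \sum_k (k == j)%:R * (\sum_l a j l * (n l)%:~R) * (d k * coval l k)).
  rewrite [X in _ = _ - X](bigD1 j) //= eqxx mul1r [X in _ = _ - (_ + X)]big1.
    by rewrite addr0 mulrC.
  by move=> k /negPf ->; rewrite !mul0r.
rewrite /copair -sumrB; apply: eq_bigr => k _; rewrite -mulrBl; congr (_ * _).
rewrite /intR ffunE intrB intrM pmulrn; congr (_ - _ * _).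
by rewrite rmorph_sum; apply: eq_bigr => i _; rewrite /= intrM.
Qed.

Lemma copair_word s n l :
  copair (intR n) (W s l) = copair (intR (ract (rev s) n)) l.
Proof.
elim: s n => [|j s IH] n; first by rewrite word_nil.
by rewrite word_cons copair_refl IH rev_cons root_act_rcons.
Qed.

Lemma copair_ge0 n l : closed_chamber D l -> nonneg n ->
  0 <= copair (intR n) l.
Proof.
move=> lC n0; apply: sumr_ge0 => k _.
by rewrite mulr_ge0 ?ler0z // mulr_ge0 ?(ltW (d_gt0 k)) //; apply: lC.
Qed.

(** If w maps alpha_i to alpha_k, then w h_i is a multiple of h_k; the factor
    is 1 because both coroots take the value 2 on their own root. *)
Lemma coval_word_root s i k l :
  ract s (sroot i) = sroot k -> coval (W s l) k = coval l i.
Proof.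
move=> sik; have E m : d k * coval (W s m) k = d i * coval m i.
  by rewrite -!copair_simple copair_word -sik root_actK.
suff dki : d k = d i.
  by apply: (mulfI (lt0r_neq0 (d_gt0 k))); rewrite E dki.
have := E (alpha i); rewrite word_alpha sik -alphaE !coval_root !gcm_diag //.
by move=> /mulIf -> //; rewrite pnatr_eq0.
Qed.

Lemma word_conj_refl s i k l :
  ract s (sroot i) = sroot k -> W s (S i l) = S k (W s l).
Proof.
move=> sik; rewrite !simple_refl_coval linearB linearZ /= (coval_word_root _ sik).
by rewrite word_alpha sik -alphaE.
Qed.

(** A positive root that is a multiple p of a simple root equals it: carrying
    the root back to alpha_i shows that p divides 1. *)
Lemma root_multiple_simple s i k n : ract s (sroot i) = n -> nonneg n ->
  (forall j, j != k -> n j = 0) -> n = sroot k.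
Proof.
move=> sn n0 nk.
have nE : n = comb (n k) 0 (sroot k) (sroot k).
  apply/ffunP => j; rewrite !ffunE mul0r addr0.
  by have [->|/nk ->] := eqVneq j k; rewrite ?mulr1 ?mulr0.
have unit_eq1 (p q : int) : 0 <= p -> p * q = 1 -> p = 1.
  by move=> p0 pq; have [q0|q0] := ltP 0 q; nia.
have : ract (rev s) n i = 1 by rewrite -sn root_actK // ffunE eqxx.
rewrite nE root_act_comb ffunE mul0r addr0 => /(unit_eq1 _ _ (n0 k)) ->.
by apply/ffunP => j; rewrite !ffunE; ring.
Qed.

Lemma root_refl_sign_change s i k :
  nonneg (ract s (sroot i)) -> nonpos (ract (k :: s) (sroot i)) ->
  ract s (sroot i) = sroot k.
Proof.
move=> s0 ks0; apply: (@root_multiple_simple s i) => // m mk.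
have := ks0 m; rewrite /= ffunE (negPf mk) mul0r subr0 => sm.
by apply/eqP; rewrite eq_le sm s0.
Qed.

(** Apply the letters of s to alpha_i from right to left. The letter k that
    first makes the root negative does so because the root was alpha_k; then
    the reflection s_i moves through the part of the word already applied,
    becomes s_k and cancels that letter. Sign coherence is assumed only for
    words no longer than s, for use in the induction that proves it. *)
Lemma deletion_coherent s i :
  (forall t, (size t <= size s)%N -> sign_coherent (ract t (sroot i))) ->
  nonpos (ract s (sroot i)) ->
  exists t, [/\ (size t < size s)%N, {subset t <= s} & W s = W (rcons t i)].
Proof.
elim: s => [_ /(_ i)|k s IH coh neg]; first by rewrite ffunE eqxx.
have [pos|neg'] := coh s (leqnSn _).
  exists s; split=> [||] //; first by move=> x xs; rewrite inE xs orbT.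
  have sik := root_refl_sign_change pos neg.
  by apply/lfunP => l; rewrite word_rcons (word_conj_refl _ sik) word_cons.
have [t tle|t [tlt ts tE]] := IH _ neg'; first by apply: coh; apply: leqW.
exists (k :: t); split=> //; last first.
  by apply/lfunP => l /=; rewrite comp_lfunE tE comp_lfunE.
by move=> x; rewrite !inE => /orP[->//|/ts ->]; rewrite orbT.
Qed.

(** Let j be the last letter of the word and write the word as v e, with e a
    word in i and j and v as short as possible. Then v maps alpha_i and alpha_j
    to positive roots, and the case of rank two applies to e. *)
Lemma root_sign_coherent s i : sign_coherent (ract s (sroot i)).
Proof.
have [N] := ubnP (size s); elim: N s i => // N IH s0 i.
case/lastP: s0 => [_|s j]; first by left=> k; rewrite ffunE; case: eqP.
rewrite size_rcons ltnS => sN.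
have [<-|ij] := eqVneq i j.
  rewrite root_act_rcons root_refl_simple // root_act_comb.
  by have [s0|s0] := IH s i sN; [right|left] => k; rewrite ffunE; have := s0 k; lia.
have [v [e [ve eij vN]]] : exists v e, [/\ W (rcons s j) = W (v ++ e),
    all (mem [set i; j]%SET) e & (size v < N)%N].
  by exists s, [:: j]; split; rewrite -?cats1 //= !inE eqxx orbT.
rewrite (word_eq_root_act _ ve) root_act_cat {s sN ve}.
(* A negative image of a rank-two simple root under v allows shortening v at
   the expense of e, so that v may be assumed to map both to positive roots. *)
have [n] := ubnP (size v); elim: n v e eij vN => // n IHn v e eij vN vn.
have shorten k : k \in [set i; j]%SET -> nonpos (ract v (sroot k)) ->
    sign_coherent (ract v (ract e (sroot i))).
  move=> kij neg; have [t tv|t [tv _ vE]] := deletion_coherent _ neg.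
    by apply: IH; apply: leq_ltn_trans vN.
  rewrite (word_eq_root_act _ vE) root_act_rcons.
  apply: (IHn t (k :: e)); first by rewrite /= kij.
    exact: ltn_trans vN.
  exact: leq_trans tv _.
have [posi|] := IH v i vN; last by apply: shorten; rewrite !inE eqxx.
have [posj|] := IH v j vN; last by apply: shorten; rewrite !inE eqxx orbT.
have [p [q [-> pq]]] := rank2_sign_coherent A_gcm ij eij.
rewrite root_act_comb; case: pq => -[p0 q0]; [left|right] => k; rewrite ffunE.
  by rewrite addr_ge0 // mulr_ge0.
by have := posi k; have := posj k; nia.
Qed.

Lemma deletion_right s i : nonpos (ract s (sroot i)) ->
  exists t, [/\ (size t < size s)%N, {subset t <= s} & W s = W (rcons t i)].
Proof. by apply: deletion_coherent => t _; apply: root_sign_coherent. Qed.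

Lemma deletion_left s i : nonpos (ract (rev s) (sroot i)) ->
  exists t, [/\ (size t < size s)%N, {subset t <= s} & W s = W (i :: t)].
Proof.
case/deletion_right => t [tlt ts tE]; exists (rev t).
rewrite size_rev; split.
- by rewrite size_rev in tlt.
- by move=> x; rewrite mem_rev => /ts; rewrite mem_rev.
- by move/word_rev_eq: tE; rewrite revK rev_rcons.
Qed.

(** * Reduced words *)

Definition is_reduced s := forall t, W s = W t -> (size s <= size t)%N.

Lemma reduced_rev s : is_reduced s -> is_reduced (rev s).
Proof.
move=> sr t /word_rev_eq; rewrite revK => /sr.
by rewrite !size_rev.
Qed.

Lemma reduced_behead i s : is_reduced (i :: s) -> is_reduced s.
Proof.
move=> sr t st; have := sr (i :: t); rewrite ltnS; apply.
by apply/lfunP => l; rewrite !word_cons st.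
Qed.

Lemma reduced_rcons_root s i :
  is_reduced (rcons s i) -> nonneg (ract s (sroot i)).
Proof.
move=> sr; have [//|/deletion_right[t [tlt _ tE]]] := root_sign_coherent s i.
have /sr : W (rcons s i) = W t.
  by apply/lfunP => l; rewrite word_rcons tE word_rcons simple_reflK.
by rewrite size_rcons ltnNge (ltnW tlt).
Qed.

(** A shorter word r for s_i w would, by deletion of a letter of r, give a
    word for w that is shorter than s. *)
Lemma reduced_cons s i :
  is_reduced s -> nonneg (ract (rev s) (sroot i)) -> is_reduced (i :: s).
Proof.
move=> sr pos r rE; rewrite leqNgt; apply/negP; rewrite ltnS => rs.
have sE : W s = W (i :: r).
  by apply/lfunP => l; rewrite word_cons -rE word_cons simple_reflK.
have /deletion_left[t [tlt _ tE]] : nonpos (ract (rev r) (sroot i)).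
  rewrite -(word_eq_root_act _ (word_rev_eq rE)) rev_cons root_act_rcons.
  rewrite root_refl_simple // root_act_comb => k.
  by rewrite ffunE; have := pos k; lia.
have /sr : W s = W t.
  by apply/lfunP => l; rewrite sE word_cons tE word_cons simple_reflK.
by rewrite leqNgt (leq_trans tlt rs).
Qed.

(** Shortening never introduces new letters; in particular elements of a
    standard parabolic subgroup have reduced expressions inside it. *)
Lemma reduced_subword s :
  exists t, [/\ is_reduced t, W t = W s & {subset t <= s}].
Proof.
have [n] := ubnP (size s); elim: n s => // n IH [|i s] sn.
  by exists [::]; split=> // t _.
have [t [tr tE ts]] := IH s sn.
have [pos|/deletion_left[r [rlt rt rE]]] := root_sign_coherent (rev t) i.
  exists (i :: t); split; first exact: reduced_cons.
    by apply/lfunP => l; rewrite !word_cons tE.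
  by move=> x; rewrite !inE => /orP[->//|/ts ->]; rewrite orbT.
have rn : (size r < n)%N.
  by apply: ltn_trans (sn : (size s < n)%N); apply: leq_trans rlt _; apply: tr.
have [q [qr qE qsub]] := IH r rn; exists q; split=> //.
  by rewrite qE; apply/lfunP => l; rewrite word_cons -tE rE word_cons simple_reflK.
by move=> x /qsub/rt/ts; rewrite inE orbC => ->.
Qed.

(** The coroot that w^-1 makes of h_i is positive for reduced s_i w. *)
Lemma reduced_cons_coval i s l : is_reduced (i :: s) -> closed_chamber D l ->
  0 <= coval (W s l) i.
Proof.
move=> sr lC.
rewrite -(pmulr_rge0 _ (d_gt0 i)) -copair_simple copair_word.
apply: copair_ge0 => //; apply: reduced_rcons_root.
by rewrite -rev_cons; apply: reduced_rev.
Qed.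

(** * The fundamental chamber and convexity of the Tits cone *)

Definition root_cone T x : Prop := exists c : I -> R,
  [/\ forall k, 0 <= c k, forall k, k \notin T -> c k = 0 & x = rcomb c].

Lemma root_cone0 T : root_cone T 0.
Proof.
exists (fun _ => 0); split=> //.
by rewrite /rcomb big1 // => k _; rewrite scale0r.
Qed.

Lemma root_coneD T x y : root_cone T x -> root_cone T y -> root_cone T (x + y).
Proof.
move=> [c [c0 cT ->]] [e [e0 eT ->]]; exists (fun k => c k + e k); split.
- by move=> k; rewrite addr_ge0.
- by move=> k kT; rewrite cT ?eT ?addr0.
- by rewrite -big_split; apply: eq_bigr => k _; rewrite scalerDl.
Qed.

Lemma root_coneZ T (p : R) x : 0 <= p -> root_cone T x -> root_cone T (p *: x).
Proof.
move=> p0 [c [c0 cT ->]]; exists (fun k => p * c k); split.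
- by move=> k; rewrite mulr_ge0.
- by move=> k kT; rewrite cT ?mulr0.
- by rewrite scaler_sumr; apply: eq_bigr => k _; rewrite scalerA.
Qed.

Lemma root_cone_alpha T i : i \in T -> root_cone T (alpha i).
Proof.
move=> iT; exists (intR (sroot i)); split=> [k|k kT|]; last exact: alphaE.
  by rewrite /intR ffunE ler0z.
by rewrite /intR ffunE (_ : k == i = false) //; apply: contraNF kT => /eqP ->.
Qed.

Lemma root_cone_pointed T J x : root_cone T x -> root_cone J (- x) -> x = 0.
Proof.
move=> [c [c0 _ xE]] [e [e0 _ yE]].
have /rcomb_eq0 ce : rcomb (fun k => c k + e k) = 0.
  rewrite -(addrN x) yE xE -big_split.
  by apply: eq_bigr => k _; rewrite scalerDl.
rewrite xE /rcomb big1 // => k _; suff -> : c k = 0 by rewrite scale0r.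
by have := ce k; have := c0 k; have := e0 k; lra.
Qed.

Lemma sub_word_cons i s l :
  l - W (i :: s) l = l - W s l + coval (W s l) i *: alpha i.
Proof. by rewrite word_cons simple_refl_coval opprB addrCA addrC. Qed.

(** Each letter of a reduced word subtracts a nonnegative multiple of its
    simple root from the image of a dominant weight. *)
Lemma chamber_sub_word T s l : all (mem T) s -> is_reduced s ->
  closed_chamber D l -> root_cone T (l - W s l).
Proof.
move=> + + lC; elim: s => [_ _|i s IH /= /andP[iT sT] sr].
  by rewrite word_nil subrr; apply: root_cone0.
rewrite sub_word_cons; apply: root_coneD.
  by apply: IH => //; apply: reduced_behead sr.
by apply: root_coneZ; [apply: reduced_cons_coval | apply: root_cone_alpha].
Qed.

Lemma all_setT s : all (mem [set: I]%SET) s.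
Proof. by apply/allP => i _; rewrite /= inE. Qed.

Lemma chamber_fixed_letters s l : is_reduced s -> closed_chamber D l ->
  W s l = l -> forall i, i \in s -> coval l i = 0.
Proof.
move=> + lC; elim: s => // i s IH sr fix_l.
have sr' := reduced_behead sr.
have iE : l - W s l + coval (W s l) i *: alpha i = 0.
  by rewrite -sub_word_cons fix_l subrr.
have Wl : W s l = l.
  apply/esym/eqP; rewrite -subr_eq0; apply/eqP.
  apply: (@root_cone_pointed [set: I]%SET [set: I]%SET).
    exact: chamber_sub_word (all_setT s) sr' lC.
  move/eqP: iE; rewrite addr_eq0 => /eqP ->; rewrite opprK.
  apply: root_coneZ; first exact: reduced_cons_coval.
  by apply: root_cone_alpha; rewrite inE.
move=> j; rewrite inE => /orP[/eqP ->|]; last exact: IH.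
have /rcomb_eq0/(_ i) : rcomb (fun k => coval l i * intR (sroot i) k) = 0.
  rewrite -iE Wl subrr add0r [in RHS]alphaE scaler_sumr.
  by apply: eq_bigr => k _; rewrite scalerA.
by rewrite /intR ffunE eqxx mulr1.
Qed.

(** If l and w l are both dominant, each is obtained from the other by
    subtracting a nonnegative combination of simple roots. *)
Lemma chamber_fundamental s l : is_reduced s -> closed_chamber D l ->
  closed_chamber D (W s l) -> W s l = l.
Proof.
move=> sr lC WlC; apply/esym/eqP; rewrite -subr_eq0; apply/eqP.
apply: (@root_cone_pointed [set: I]%SET [set: I]%SET).
  exact: chamber_sub_word (all_setT s) sr lC.
rewrite opprB -{2}(wordK s l).
exact: chamber_sub_word (all_setT _) (reduced_rev sr) WlC.
Qed.

Definition pos_root T (n : {ffun I -> int}) : Prop :=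
  exists s i, [/\ all (mem T) s, i \in T, n = ract s (sroot i) & nonneg n].

Lemma pos_root_simple T i : i \in T -> pos_root T (sroot i).
Proof.
by move=> iT; exists [::], i; split=> // k; rewrite ffunE; case: eqP.
Qed.

Lemma pos_root_refl T i n : i \in T -> pos_root T n -> n != sroot i ->
  pos_root T (root_refl A i n).
Proof.
move=> iT [s [k [sT kT nE n0]]] ni; exists (i :: s), k.
split; rewrite /= -?nE ?iT //.
have := root_sign_coherent (i :: s) k; rewrite /= -nE => -[//|neg].
case/eqP: ni; rewrite nE; apply: root_refl_sign_change; first by rewrite -nE.
by rewrite /= -nE.
Qed.

(** Reflecting in a simple root on which z is negative removes that root from
    the set of positive roots negative on z and permutes the others. *)
Lemma dominant_conjugate T z (L : seq {ffun I -> int}) :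
  (forall n, pos_root T n -> copair (intR n) z < 0 -> n \in L) ->
  exists2 s, all (mem T) s & forall i, i \in T -> 0 <= coval (W s z) i.
Proof.
have [N] := ubnP (size L); elim: N L z => // N IH L z LN zL.
have [[i iT zi]|dom] := pselect (exists2 i, i \in T & coval z i < 0); last first.
  exists [::] => // i iT; rewrite word_nil leNgt; apply/negP => zi.
  by apply: dom; exists i.
have iL : sroot i \in L.
  by apply: zL; [apply: pos_root_simple | rewrite copair_simple pmulr_rlt0].
pose L' := [seq root_refl A i n | n <- [seq n <- L | n != sroot i]].
have [|n nT nz|s sT sz] := IH L' (S i z).
- rewrite size_map; apply: leq_trans (LN : (size L <= N)%N).
  rewrite size_filter ltn_neqAle count_size andbT -all_count.
  by apply/allPn; exists (sroot i); rewrite ?eqxx.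
- have ni : n != sroot i.
    apply: contraTneq nz => ->; rewrite copair_simple coval_refl_diag mulrN.
    by rewrite oppr_lt0 -leNgt ltW // pmulr_rlt0.
  have nT' := pos_root_refl iT nT ni.
  apply/mapP; exists (root_refl A i n); last by rewrite root_reflK.
  rewrite mem_filter zL -?copair_refl // andbT.
  apply/eqP => nE; case: nT => s' [k [_ _ _ /(_ i)]].
  by rewrite -[n](root_reflK A_gcm i) nE root_refl_simple // !ffunE eqxx.
- exists (rcons s i); first by rewrite all_rcons /= iT.
  by move=> j /sz; rewrite word_rcons.
Qed.

Lemma weyl_word s : weyl D (W s).
Proof. by exists s => //; apply: all_setT. Qed.

Lemma tits_coneP z : tits_cone D z <->
  exists s l, [/\ is_reduced s, closed_chamber D l & z = W s l].
Proof.
split=> [[_ [l [[s _ ->] lC ->]]]|[s [l [sr lC ->]]]].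
  by have [t [tr tE _]] := reduced_subword s; exists t, l; rewrite tE.
by exists (W s), l; split=> //; apply: weyl_word.
Qed.

Lemma tits_cone_word s z : tits_cone D z -> tits_cone D (W s z).
Proof.
case=> _ [l [[t _ ->] lC ->]]; exists (W (s ++ t)), l; split=> //.
  exact: weyl_word.
by rewrite word_cat.
Qed.

Lemma tits_cone_neg_roots z : tits_cone D z ->
  exists L : seq {ffun I -> int}, forall n, pos_root [set: I]%SET n ->
    copair (intR n) z < 0 -> n \in L.
Proof.
case/tits_coneP=> s [l [_ lC ->]] {z}; elim: s => [|i s [L LP]].
  exists [::] => n [_ [_ [_ _ _ n0]]]; rewrite word_nil.
  by rewrite ltNge copair_ge0.
exists (sroot i :: [seq root_refl A i n | n <- L]) => n nP.
rewrite word_cons copair_refl inE; have [//|ni] := eqVneq n (sroot i).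
move/LP => /(_ (pos_root_refl _ nP ni)); rewrite inE => /(_ isT) nL.
by apply/mapP; exists (root_refl A i n); rewrite ?root_reflK.
Qed.

(** The Tits cone consists of the weights that are negative on finitely many
    positive roots only, and this condition is stable under convex
    combinations. *)
Lemma tits_cone_convex x y (t : R) : tits_cone D x -> tits_cone D y ->
  0 <= t <= 1 -> tits_cone D (t *: x + (1 - t) *: y).
Proof.
move=> /tits_cone_neg_roots[L LP] /tits_cone_neg_roots[M MP] /andP[t0 t1].
have [n nP|s _ sC] :=
  @dominant_conjugate [set: I]%SET (t *: x + (1 - t) *: y) (L ++ M).
  rewrite copair_lin mem_cat => neg.
  have [x0|/(LP _ nP) ->//] := leP 0 (copair (intR n) x).
  have [y0|/(MP _ nP) ->] := leP 0 (copair (intR n) y); last by rewrite orbT.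
  move: neg; rewrite ltNge addr_ge0 // mulr_ge0 // subr_ge0 //.
rewrite -(wordK s (_ + _)); apply: tits_cone_word.
exists (W [::]), (W s (t *: x + (1 - t) *: y)); split; first exact: weyl_word.
  by move=> i; apply: sC; rewrite inE.
by rewrite word_nil.
Qed.

(** All roots in the orbit of alpha_i have the norm of alpha_i. *)
Lemma pos_root_norm T n : pos_root T n ->
  \sum_i d i * ((n i)%:~R * cartan_mul A (intR n) i) <= \sum_i d i * 2.
Proof.
case=> s [i [_ _ nE _]].
have -> : \sum_i d i * ((n i)%:~R * cartan_mul A (intR n) i) =
    copair (intR n) (rcomb (intR n)).
  apply: eq_bigr => k _; rewrite coval_sum mulrCA; congr (_ * (_ * _)).
  by apply: eq_bigr => j _; rewrite covalZ coval_root mulrC.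
rewrite nE -word_alpha copair_word root_actK // copair_simple coval_root.
rewrite gcm_diag // (bigD1 i) //= lerDl.
by apply: sumr_ge0 => j _; rewrite mulr_ge0 ?ltW.
Qed.

Lemma fin_witnessed_pos_roots T : fin_witnessed R A T ->
  exists L : seq {ffun I -> int}, forall n, pos_root T n -> n \in L.
Proof.
move=> Tfin.
have [N NP] := integer_vectors_bounded A_gcm d_gt0 d_sym (\sum_i d i * 2) Tfin.
exists [seq [ffun k => (f k : nat)%:Z] | f : {ffun I -> 'I_N.+1}] => n nT.
have [s [i [sT iT nE n0]]] := nT.
apply/fintype.imageP; exists [ffun k => inord `|n k|%N] => //.
apply/ffunP => k; rewrite !ffunE inordK ?gez0_abs // ltnS.
rewrite -lez_nat gez0_abs //; apply: NP => //; last exact: pos_root_norm nT.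
move=> j jT; rewrite nE; apply: root_act_support jT => // m mT.
by rewrite ffunE (_ : m == i = false) //; apply: contraNF mT => /eqP ->.
Qed.

Lemma fin_dominant_conjugate T z : fin_witnessed R A T ->
  exists2 s, all (mem T) s & forall i, i \in T -> 0 <= coval (W s z) i.
Proof.
by case/fin_witnessed_pos_roots=> L LP; apply: (@dominant_conjugate _ _ L) => n /LP.
Qed.

(** * Faces of the Tits cone *)

Lemma parabolic_fix T s l : all (mem T) s ->
  (forall i, i \in T -> coval l i = 0) -> W s l = l.
Proof. by move=> /allP sT lT; apply: word_fix => i /sT /lT. Qed.

Lemma Rface_coval T l i : Rface D T l -> i \in T -> coval l i = 0.
Proof.
case=> _ [m [[s sT ->] _ mT ->]] iT.
by rewrite (coval_word_orth _ sT iT); apply: mT.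
Qed.

Lemma Rface_tits T l : Rface D T l -> tits_cone D l.
Proof.
case=> _ [m [[s _ ->] mC _ ->]]; exists (W s), m; split=> //.
exact: weyl_word.
Qed.

Lemma Rface_word T s l : all (mem (perp A T)) s -> Rface D T l -> Rface D T (W s l).
Proof.
move=> sT [_ [m [[t tT ->] mC mT ->]]]; exists (W (s ++ t)), m; split=> //.
  by exists (s ++ t) => //; rewrite all_cat sT.
by rewrite word_cat.
Qed.

Lemma Rface_chamber T l : closed_chamber D l ->
  (forall i, i \in T -> coval l i = 0) -> Rface D T l.
Proof.
by move=> lC lT; exists (W [::]), l; split=> //; [exists [::] | rewrite word_nil].
Qed.

Lemma copair_alpha c i : copair c (alpha i) = d i * cartan_mul A c i.
Proof.
rewrite /copair /cartan_mul mulr_sumr; apply: eq_bigr => k _.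
by rewrite coval_root d_sym; ring.
Qed.

(** For a witness c of T the functional copair c behaves as an imaginary
    coroot: it is nonpositive on all simple roots, so its value on a dominant
    weight only grows along a reduced word. If the value is 0 at the end, then
    each letter of the word either acts trivially or is orthogonal to T. *)
Lemma copair_tits T c s l :
  (forall i, i \in T -> 0 < c i) -> (forall i, i \notin T -> c i = 0) ->
  (forall i, i \in T -> cartan_mul A c i <= 0) ->
  is_reduced s -> closed_chamber D l ->
  0 <= copair c (W s l) /\ (copair c (W s l) = 0 -> Rface D T (W s l)).
Proof.
move=> c0 c1 c2 + lC; have c3 := witness_ge0 c0 c1.
have cle i : cartan_mul A c i <= 0.
  by have [/c2//|/c1/(cartan_mul_off_le0 A_gcm c3)] := boolP (i \in T).
elim: s => [_|i s IH sr].
  rewrite word_nil.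
  have t0 k : 0 <= c k * (d k * coval l k).
    by rewrite !mulr_ge0 // ?(ltW (d_gt0 k)) //; apply: lC.
  split=> [|/eqP]; first by apply: sumr_ge0.
  rewrite psumr_eq0 // => /allP cl; apply: Rface_chamber => // k kT.
  have := cl k (mem_index_enum k).
  rewrite !mulf_eq0 (gt_eqF (c0 k kT)) (gt_eqF (d_gt0 k)) /=.
  by move/eqP.
have [IH1 IH2] := IH (reduced_behead sr).
have li := reduced_cons_coval sr lC.
have E : copair c (W (i :: s) l) =
    copair c (W s l) + coval (W s l) i * (- (d i * cartan_mul A c i)).
  rewrite word_cons simple_refl_coval -[W s l in LHS]scale1r -scaleNr copair_lin.
  by rewrite covalZ copair_alpha !mul1r; ring.
have ci0 : 0 <= - (d i * cartan_mul A c i).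
  by rewrite oppr_ge0 pmulr_rle0.
have step0 := mulr_ge0 li ci0.
rewrite E; split=> [|/eqP]; first exact: addr_ge0.
rewrite paddr_eq0 // => /andP[/eqP/IH2 sT].
rewrite word_cons mulf_eq0 => /orP[/eqP/simple_refl_fix -> //|].
rewrite oppr_eq0 mulf_eq0 gt_eqF //= => /eqP ci.
have [iT|iT] := boolP (i \in T).
  by rewrite simple_refl_fix // (Rface_coval sT).
have iP : i \in perp A T.
  rewrite inE; apply/forall_inP => j jT.
  have ij : i != j by apply: contraNneq iT => ->.
  have /eqP : \sum_k - (a i k * c k) = 0.
    by rewrite sumrN -/(cartan_mul A c i) ci oppr0.
  rewrite psumr_eq0 => [/allP/(_ j (mem_index_enum j))|k _].
    by rewrite /= oppr_eq0 mulf_eq0 intr_eq0 (gt_eqF (c0 _ jT)) orbF.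
  rewrite oppr_ge0; have [->|ik] := eqVneq k i; first by rewrite c1 // mulr0.
  by rewrite mulr_le0_ge0 // gcm_off // eq_sym.
have := @Rface_word T [:: i] _ _ sT; rewrite word_cons word_nil; apply.
by rewrite /= iP.
Qed.

(** The functional of a witness of T vanishes on any weight that vanishes on
    T, so the preceding lemma applies. *)
Lemma RfaceE T l : inf_witnessed R A T ->
  Rface D T l <-> tits_cone D l /\ forall i, i \in T -> coval l i = 0.
Proof.
move=> [c [c0 c1 c2]]; split=> [lT|[/tits_coneP[s [m [sr mC ->]]] lT]].
  by split; [apply: Rface_tits lT | move=> i; apply: Rface_coval].
have [_] := copair_tits c0 c1 c2 sr mC; apply.
apply: big1 => k _; have [/lT ->|/c1 ->] := boolP (k \in T).
  by rewrite !mulr0.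
by rewrite mul0r.
Qed.

(** The face is exposed: on the Tits cone it is the zero set of a nonnegative
    functional. *)
Lemma Rface_is_face T : inf_witnessed R A T -> is_face D (Rface D T).
Proof.
move=> Tinf; have [c [c0 c1 c2]] := Tinf.
have cR x : tits_cone D x -> 0 <= copair c x /\ (copair c x = 0 -> Rface D T x).
  by case/tits_coneP=> s [m [sr mC ->]]; apply: (copair_tits c0).
split.
- exists 0; apply: Rface_chamber => [i|i _]; last by rewrite /coval zero_lfunE.
  by rewrite zero_lfunE.
- by move=> x; apply: Rface_tits.
- move=> x y t /(RfaceE _ Tinf)[xX xT] /(RfaceE _ Tinf)[yX yT] t01.
  apply/(RfaceE _ Tinf); split; first exact: tits_cone_convex.
  by move=> i iT; rewrite covalD !covalZ xT // yT // !mulr0 addr0.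
- move=> x y t /cR[x0 xR] /cR[y0 yR] /andP[t0 t1] xyR.
  have : copair c (t *: x + (1 - t) *: y) = 0.
    apply: big1 => k _; have [kT|/c1 ->] := boolP (k \in T).
      by rewrite (Rface_coval xyR kT) !mulr0.
    by rewrite mul0r.
  rewrite copair_lin => /eqP.
  rewrite paddr_eq0 ?mulr_ge0 ?subr_ge0 // ?ltW // => /andP[].
  rewrite !mulf_eq0 (gt_eqF t0) /= subr_eq0 (gt_eqF t1) /=.
  by move=> /eqP/xR ? /eqP/yR.
Qed.

(** * Faces through dominant weights *)
Definition vanishing l : {set I} := [set i | coval l i == 0]%SET.

Lemma chamber_perturbation (l m : V) : closed_chamber D l ->
  (forall i, coval l i = 0 -> 0 <= coval m i) ->
  exists2 e : R, 0 < e & closed_chamber D (l + e *: m).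
Proof.
move=> lC lm; pose b := \sum_i `|coval m i| / coval l i.
have b_term i : 0 <= `|coval m i| / coval l i.
  by rewrite divr_ge0 //; apply: lC.
have b0 : 0 <= b by apply: sumr_ge0.
have b1 : 0 < 1 + b by rewrite ltr_pwDl.
exists (1 + b)^-1; first by rewrite invr_gt0.
move=> i; rewrite -/(coval _ i) covalD covalZ.
have [/eqP li|li] := eqVneq (coval l i) 0.
  by rewrite (eqP li) add0r mulr_ge0 ?invr_ge0 ?(ltW b1) //; apply/lm/eqP.
have {}li : 0 < coval l i by rewrite lt_neqAle eq_sym li; apply: lC.
have mb : `|coval m i| <= b * coval l i.
  rewrite -ler_pdivrMr //.
  by rewrite /b (bigD1 i) //= lerDl; apply: sumr_ge0.
have -> : coval l i + (1 + b)^-1 * coval m i =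
    (1 + b)^-1 * ((1 + b) * coval l i + coval m i) by field; rewrite gt_eqF.
apply: mulr_ge0; first by rewrite invr_ge0 ltW.
have := ler_norm (- coval m i); rewrite normrN.
by have := ltW li; lra.
Qed.

(** The segment from m to l can be prolonged beyond l inside the Tits cone, so
    l is an inner point of a segment that ends at m. Indeed l - m vanishes on
    the core; the rest of the vanishing set is of finite type, so an element s
    of its finite Weyl group, which fixes l, makes l - m dominant there; the
    remaining values of l are positive and absorb a small perturbation. *)
Lemma face_contains_Rface H l m : is_face D H -> H l -> closed_chamber D l ->
  Rface D (inf_core R A (vanishing l)) m -> H m.
Proof.
move=> [_ _ _ Hext] Hl lC mR.
set J := vanishing l; set M := inf_core R A J.
have lJ i : i \in J -> coval l i = 0 by rewrite inE => /eqP.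
have MJ i : i \in M -> i \in J := fintype.subsetP (inf_core_sub R A J) i.
have [s sJ sdom] := fin_dominant_conjugate (l - m) (inf_core_fin R A_gcm J).
have sl : W s l = l.
  by apply: parabolic_fix sJ _ => i; rewrite inE => /andP[_ /lJ].
have sM : all (mem (perp A M)) s.
  apply/allP => i /(allP sJ) iJ.
  exact: fintype.subsetP (inf_core_perp R A_gcm J) i iJ.
have [|e e0 eC] := @chamber_perturbation l (W s (l - m)) lC.
  move=> i /eqP li; have iJ : i \in J by rewrite inE.
  have [iM|iM] := boolP (i \in M); last by apply: sdom; rewrite inE iM.
  by rewrite (coval_word_orth _ sM iM) covalB lJ // (Rface_coval mR) // subr0.
pose x := l + e *: (l - m).
have xX : tits_cone D x.
  rewrite -(wordK s x); apply: tits_cone_word.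
  exists (W [::]), (W s x); split; rewrite ?word_nil //; first exact: weyl_word.
  by rewrite linearD linearZ /= sl.
have e1 : 0 < 1 + e by rewrite ltr_pwDl // ltW.
have lE : l = (e / (1 + e)) *: m + (1 - e / (1 + e)) *: x.
  rewrite /x scalerDr scalerA scalerBr.
  have -> : (1 - e / (1 + e)) * e = e / (1 + e) by field; rewrite gt_eqF.
  by rewrite addrC addrA subrK -scalerDl subrK scale1r.
have [] // := Hext m x (e / (1 + e)) (Rface_tits mR) xX.
  by rewrite divr_gt0 // ltr_pdivrMr // mul1r ltrDr ltr01.
by rewrite -lE.
Qed.

Lemma generic_weight T : exists l : V,
  closed_chamber D l /\ forall i, (coval l i == 0) = (i \in T).
Proof.
have [l lE] := weight_exists (fun i => if i \in T then 0 else 1).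
exists l; split=> i; last by rewrite lE; case: ifP; rewrite ?eqxx ?oner_eq0.
by rewrite -/(coval l i) lE; case: ifP.
Qed.

(** For the direct implication, follow a dominant weight of R(T') whose
    stabilizer is exactly W_T': it is carried into R(T), hence equals its
    dominant representative there, and what remains lies in its stabilizer. *)
Lemma word_Rface_subset s s' T T' : inf_witnessed R A T -> inf_witnessed R A T' ->
  W s' @` Rface D T' `<=` W s @` Rface D T <->
  T \subset T' /\
  exists u v, [/\ parabolic D (perp A T) u, parabolic D T' v
                & ((W s)^-1 \o W s')%VF = (u \o v)%VF].
Proof.
move=> Tinf T'inf; rewrite word_inv -word_cat_comp; split.
  have [m [mC mT']] := generic_weight T'.
  have mR : Rface D T' m.
    by apply: Rface_chamber => // i; rewrite -mT' => /eqP.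
  move=> /(_ (W s' m)) []; first by exists m.
  move=> _ [_ [l [[u uT ->] lC lT ->]]] sul.
  have [t [tr tE _]] := reduced_subword (rev u ++ rev s ++ s').
  have tm : W t m = l.
    by rewrite tE !word_cat -sul !wordK.
  have tm' : W t m = m by apply: chamber_fundamental => //; rewrite tm.
  have lm : l = m by rewrite -tm tm'.
  split; first by apply/fintype.subsetP => i /lT; rewrite lm -mT' => /eqP.
  exists (W u), (W t); split; first by exists u.
    exists t => //; apply/allP => i it; rewrite /= -mT'; apply/eqP.
    exact: chamber_fixed_letters tr mC tm' _ it.
  by apply/lfunP => x; rewrite comp_lfunE tE [in RHS]word_cat word_revK.
move=> [/fintype.subsetP TT' [_ [_ [[u uT ->] [v vT' ->] sE]]]] _ [l lR <-].
exists (W u l).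
  apply: Rface_word => //; apply/(RfaceE _ Tinf); split.
    exact: Rface_tits lR.
  by move=> i /TT'; apply: Rface_coval.
rewrite -[in RHS](word_revK s (W s' l)) -(word_cat (rev s)) sE comp_lfunE.
rewrite (parabolic_fix vT') // => i; exact: Rface_coval.
Qed.

Lemma word_Rface_subset_eq s s' T : inf_witnessed R A T ->
  W s' @` Rface D T `<=` W s @` Rface D T ->
  W s' @` Rface D T = W s @` Rface D T.
Proof.
move=> Tinf sub; apply/seteqP; split=> //.
have [_ [_ [_ [[u uT ->] [v vT ->]]]]] := (word_Rface_subset s s' Tinf Tinf).1 sub.
rewrite word_inv -(word_cat_comp (rev s)) => sE _ [l lR <-].
exists (W (rev u) l); first by apply: Rface_word => //; rewrite all_rev.
have vl : W v (W (rev u) l) = W (rev u) l.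
  apply: (parabolic_fix vT) => i; apply: Rface_coval.
  by apply: Rface_word => //; rewrite all_rev.
move/lfunP/(_ (W (rev u) l)): sE; rewrite comp_lfunE vl word_revK word_cat => lE.
by rewrite -[in RHS]lE word_revK.
Qed.

(** * Minimal double coset representatives *)

Lemma reduced_wordP w s : reduced_word D w s <-> w = W s /\ is_reduced s.
Proof. by split=> -[-> sr]. Qed.

Lemma weyl_length_reduced s : is_reduced s -> weyl_length D (W s) = size s.
Proof.
move=> sr; rewrite /weyl_length.
have [|t [tE tr] <-] :=
  @getPex _ [set n | exists2 t, reduced_word D (W s) t & size t = n].
  by exists (size s); exists s => //; split.
by apply/eqP; rewrite eqn_leq sr // tr.
Qed.

Lemma weyl_length_le s : (weyl_length D (W s) <= size s)%N.
Proof.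
have [t [tr tE _]] := reduced_subword s; rewrite -tE weyl_length_reduced //.
exact: tr.
Qed.

Lemma parabolic_simple J j : j \in J -> parabolic D J (W [:: j]).
Proof. by move=> jJ; exists [:: j]; rewrite //= jJ. Qed.

(** If w made alpha_j negative, deletion would make w s_j shorter than w. *)
Lemma min_repr_root J s j : min_repr D J (W s) -> j \in J ->
  nonneg (ract s (sroot j)).
Proof.
have [r [rr rE _]] := reduced_subword s; move=> [_ smin] jJ.
rewrite -(word_eq_root_act _ rE).
have [//|/deletion_right[t [tlt _ tE]]] := root_sign_coherent r j.
have := smin _ (parabolic_simple jJ).
have -> : (W s \o W [:: j])%VF = W t.
  apply/lfunP => l.
  by rewrite comp_lfunE -rE tE word_rcons word_cons word_nil simple_reflK.
rewrite -rE weyl_length_reduced // => /leq_trans/(_ (weyl_length_le t)).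
by rewrite leqNgt tlt.
Qed.

Lemma min_lrepr_root K s k : min_lrepr D K (W s) -> k \in K ->
  nonneg (ract (rev s) (sroot k)).
Proof.
have [r [rr rE _]] := reduced_subword s; move=> [_ smin] kK.
rewrite -(word_eq_root_act _ (word_rev_eq rE)).
have [//|/deletion_left[t [tlt _ tE]]] := root_sign_coherent (rev r) k.
have := smin _ (parabolic_simple kK).
have -> : (W [:: k] \o W s)%VF = W t.
  by apply/lfunP => l; rewrite comp_lfunE -rE tE !word_cons word_nil simple_reflK.
rewrite -rE weyl_length_reduced // => /leq_trans/(_ (weyl_length_le t)).
by rewrite leqNgt tlt.
Qed.

Lemma root_cone_word T s x : (forall i, i \in T -> nonneg (ract s (sroot i))) ->
  root_cone T x -> root_cone [set: I]%SET (W s x).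
Proof.
move=> sT [c [c0 cT ->]]; rewrite /rcomb linear_sum.
apply: (big_ind (root_cone [set: I]%SET)); first exact: root_cone0.
  by move=> y z; apply: root_coneD.
move=> k _; rewrite linearZ /=; have [kT|/cT ->] := boolP (k \in T).
  apply: root_coneZ => //; rewrite word_alpha.
  exists (intR (ract s (sroot k))); split=> // j; last by rewrite inE.
  by rewrite /intR ler0z; apply: sT.
by rewrite scale0r; apply: root_cone0.
Qed.

Lemma root_cone_summand J K T x y : root_cone J x -> root_cone K y ->
  root_cone T (x + y) -> root_cone T x.
Proof.
move=> [p [p0 _ ->]] [q [q0 _ ->]] [c [c0 cT cE]]; exists p; split=> // k kT.
have /rcomb_inj/(_ k) : rcomb c = rcomb (fun i => p i + q i).
  by rewrite -cE -big_split; apply: eq_bigr => i _; rewrite scalerDl.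
by rewrite cT // => /esym/eqP; rewrite paddr_eq0 // => /andP[/eqP].
Qed.

Lemma chamber_sub_parabolic T s l : all (mem T) s -> closed_chamber D l ->
  root_cone T (l - W s l).
Proof.
move=> /allP sT lC; have [t [tr <- ts]] := reduced_subword s.
by apply: chamber_sub_word => //; apply/allP => i /ts /sT.
Qed.

(** With w = W s, the identity l - u l = (l - w l) + w (l - v l) exhibits
    l - w l as a nonnegative combination of simple roots of K, all of which
    w^-1 keeps positive. But w^-1 maps l - w l to w^-1 l - l, a combination
    with nonpositive coefficients, so both vanish. *)
Lemma double_coset_fix K (L : {set I}) s (u v : seq I) l :
  (forall i, i \in L -> nonneg (ract s (sroot i))) ->
  (forall i, i \in K -> nonneg (ract (rev s) (sroot i))) ->
  all (mem K) u -> all (mem L) v -> closed_chamber D l ->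
  W u l = W s (W v l) -> W s l = l.
Proof.
move=> sL sK uK vL lC uE.
have lK : root_cone K (l - W s l).
  apply: (@root_cone_summand [set: I]%SET [set: I]%SET K _ (W s (l - W v l))).
  - exact: chamber_sub_parabolic (all_setT s) lC.
  - by apply: root_cone_word sL _; apply: chamber_sub_parabolic.
  - by rewrite linearB /= -uE addrA subrK; apply: chamber_sub_parabolic.
suff : W (rev s) (l - W s l) = 0.
  move/(congr1 (W s)); rewrite word_revK linear0 => /eqP.
  by rewrite subr_eq0 => /eqP.
apply: (@root_cone_pointed [set: I]%SET [set: I]%SET).
  exact: root_cone_word sK lK.
rewrite linearB /= wordK opprB.
exact: chamber_sub_parabolic (all_setT _) lC.
Qed.

Lemma root_act_orth (M : {set I}) s (z : I) : all (mem M) s -> z \in perp A M ->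
  ract s (sroot z) = sroot z.
Proof.
move=> + zM; elim: s => //= j s IH /andP[jM sM]; rewrite IH //.
apply/ffunP => k; rewrite ffunE cartan_sum_simple.
move: zM; rewrite inE => /forall_inP/(_ j jM).
by rewrite (gcm_sym0 A_gcm) => /eqP ->; rewrite mulr0 subr0.
Qed.

Lemma perp_sub T (M : {set I}) : T \subset M -> perp A M \subset perp A T.
Proof.
move=> /fintype.subsetP TM; apply/fintype.subsetP => i.
rewrite !inE => /forall_inP iM.
by apply/forall_inP => j /TM/iM.
Qed.

Lemma mem_red i s : is_reduced s -> i \in s -> i \in red D (W s).
Proof. by move=> sr si; rewrite inE; apply/asboolP; exists s => //; split. Qed.

(** A letter of w outside the core of the union is orthogonal to the core. In
    a reduced expression the first such letter commutes with all letters
    before it, so it can be moved to the front, where minimality of w on the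
    side of T1 and its orthogonal forbids it. *)
Lemma inf_witnessed_red (T1 T2 : {set I}) w :
  inf_witnessed R A T1 -> inf_witnessed R A T2 ->
  min_lrepr D (T1 :|: perp A T1) w ->
  inf_witnessed R A (T1 :|: T2 :|: red D w).
Proof.
move=> T1i T2i [_ wmin]; set T := _ :|: red D w.
set M := inf_core R A T.
have T12M : T1 :|: T2 \subset M.
  apply: inf_core_max; first by rewrite finset.subsetUl.
  exact: inf_witnessedU.
suff -> : T = M by apply: inf_core_witnessed.
apply/eqP; rewrite finset.eqEsubset inf_core_sub andbT.
apply/fintype.subsetP => k kT; apply: contraT => kM.
have kred : k \in red D w.
  move: kT; rewrite !finset.in_setU -orbA => /or3P[kT|kT|//]; case/negP: kM.
    by apply: (fintype.subsetP T12M); rewrite inE kT.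
  by apply: (fintype.subsetP T12M); rewrite inE kT orbT.
move: kred; rewrite inE => /asboolP[s /reduced_wordP[wE sr] ks].
have sT i : i \in s -> i \in T.
  move=> si; rewrite !inE; apply/orP; right; apply/asboolP; exists s => //.
  exact/reduced_wordP.
have hasZ : has [pred i | i \notin M] s by apply/hasP; exists k.
case: (split_find hasZ) sr ks sT wE => z p q zM pM sr _ sT wE.
rewrite /= in zM.
have zP : z \in perp A M.
  apply: (fintype.subsetP (inf_core_perp R A_gcm T)); rewrite finset.in_setD zM.
  by apply: sT; rewrite mem_cat mem_rcons inE eqxx.
have pM' : all (mem M) p.
  apply/allP => i ip; apply: contraT => iM; case/hasP: pM; by exists i.
have zK : z \in T1 :|: perp A T1.
  rewrite inE; apply/orP; right; apply: fintype.subsetP zP.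
  by apply: perp_sub; apply: fintype.subset_trans T12M; rewrite finset.subsetUl.
have := wmin _ (parabolic_simple zK).
have -> : (W [:: z] \o w)%VF = W (p ++ q).
  apply/lfunP => l; rewrite comp_lfunE wE !word_cat word_rcons !word_cons word_nil.
  by rewrite (word_conj_refl _ (root_act_orth pM' zP)) simple_reflK.
rewrite wE weyl_length_reduced // => /leq_trans/(_ (weyl_length_le _)).
by rewrite !size_cat size_rcons addSn ltnn.
Qed.

(** * The lattice operations *)
Lemma word_rcombE s c :
  W s (rcomb c) = rcomb (fun j => \sum_k c k * intR (ract s (sroot k)) j).
Proof.
rewrite /rcomb linear_sum.
transitivity (\sum_k \sum_j (c k * intR (ract s (sroot k)) j) *: alpha j).
  apply: eq_bigr => k _; rewrite linearZ /= word_alpha /rcomb scaler_sumr.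
  by apply: eq_bigr => j _; rewrite scalerA.
by rewrite exchange_big; apply: eq_bigr => j _; rewrite -scaler_suml.
Qed.

(** If a nonnegative combination of positive roots is a simple root, every root
    that occurs in it is a multiple of that simple root, hence equal to it. *)
Lemma root_act_summand (L : {set I}) s n j k :
  (forall i, i \in L -> nonneg (ract s (sroot i))) ->
  nonneg n -> (forall i, i \notin L -> n i = 0) ->
  ract s n = sroot k -> 0 < n j -> ract s (sroot j) = sroot k.
Proof.
move=> sL n0 nL sn nj.
have jL : j \in L by apply: contraTT nj => /nL ->.
apply: (@root_multiple_simple s j) => //; first exact: sL.
move=> i ik; have := word_rcombE s (intR n); rewrite word_rcomb sn.
have -> : rcomb (intR (sroot k)) = rcomb (fun j => (j == k)%:R).
  by apply: eq_bigr => l _; rewrite /intR ffunE pmulrn.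
move=> /rcomb_inj/(_ i)/esym/eqP; rewrite (negPf ik).
rewrite psumr_eq0 => [/allP/(_ j (mem_index_enum j))|p _].
  rewrite /= mulf_eq0 /intR !intr_eq0 (gt_eqF nj) /=.
  by move/eqP.
have [pL|/nL np] := boolP (p \in L); last by rewrite /intR np mul0r.
by rewrite mulr_ge0 // ler0z //; apply: sL.
Qed.

Definition parallel_part K s (L : {set I}) : {set I} :=
  [set k in K | [forall j, (j \notin L) ==> (ract s (sroot k) j == 0)]]%SET.

Lemma root_cone_parallel K (L : {set I}) s x :
  (forall i, i \in K -> nonneg (ract s (sroot i))) ->
  root_cone K x -> root_cone L (W s x) -> root_cone (parallel_part K s L) x.
Proof.
move=> sK [c [c0 cK ->]] [e [_ eL]]; rewrite word_rcombE => ce.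
exists c; split=> // k; rewrite inE negb_and => /orP[/cK //|].
rewrite negb_forall => /existsP[j]; rewrite negb_imply => /andP[jL nj].
have /eqP := rcomb_inj ce j; rewrite eL //.
rewrite psumr_eq0 => [/allP/(_ k (mem_index_enum k))|p _].
  by rewrite /= mulf_eq0 /intR intr_eq0 (negPf nj) orbF => /eqP.
have [pK|/cK ->] := boolP (p \in K); last by rewrite mul0r.
by rewrite mulr_ge0 // ler0z //; apply: sK.
Qed.

Lemma root_act_notin s n k : k \notin s -> ract s n k = n k.
Proof.
elim: s => //= j s IH; rewrite inE negb_or => /andP[kj /IH <-].
by rewrite ffunE (negPf kj) mul0r subr0.
Qed.

(** Each letter of s contributes to W s alpha_k - alpha_k a nonnegative multiple
    of a positive root, so alpha_k is fixed only when all these contributions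
    vanish. *)
Lemma fixed_simple_root_orth s k : is_reduced s -> k \notin s ->
  ract s (sroot k) = sroot k -> forall i, i \in s -> A k i = 0.
Proof.
elim/last_ind: s => // s i IH sr; rewrite mem_rcons inE negb_or => /andP[ki ks].
have {}IH := IH _ ks; rewrite root_act_rcons => fix_k.
have pos_k : nonneg (ract s (sroot k)).
  have [//|/(_ k)] := root_sign_coherent s k.
  by rewrite root_act_notin // ffunE eqxx.
have pos_i := reduced_rcons_root sr.
have Aik : A i k <= 0 by case: A_gcm => _ + _; apply; rewrite eq_sym.
have splitE : ract s (root_refl A i (sroot k)) =
    comb 1 (- A i k) (ract s (sroot k)) (ract s (sroot i)).
  rewrite -root_act_comb; congr (ract s _); apply/ffunP => j.
  by rewrite !ffunE cartan_sum_simple; ring.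
have coord j : j != k -> ract s (sroot k) j = 0 /\ A i k * ract s (sroot i) j = 0.
  move=> jk; have := congr1 (fun f : {ffun I -> int} => f j) fix_k.
  rewrite splitE !ffunE (negPf jk).
  by have := pos_k j; have := pos_i j; nia.
have sk : ract s (sroot k) = sroot k.
  by apply: (@root_multiple_simple s k) => // j /coord[].
have Aik0 : A i k = 0.
  have [//|Ain0] := eqVneq (A i k) 0.
  have si : ract s (sroot i) = sroot k.
    apply: (@root_multiple_simple s i) => // j /coord[_ /eqP].
    by rewrite mulf_eq0 (negPf Ain0) => /eqP.
  have := congr1 (fun n : {ffun I -> int} => n i)
    (can_inj (root_actK A_gcm s) (etrans si (esym sk))).
  by rewrite !ffunE eqxx eq_sym (negPf ki).
move=> j; rewrite mem_rcons inE => /orP[/eqP ->|js].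
  by apply/eqP; rewrite gcm_sym0 // Aik0.
apply: IH => //; move: sr => /reduced_rev; rewrite rev_rcons.
by move=> /reduced_behead/reduced_rev; rewrite revK.
Qed.

(** A letter that effectively moves the weight appears in the support of
    l - w l. It is not in T, where the weight vanishes, so it is orthogonal to
    T and keeps the weight in the face. *)
Lemma Rface_orth_support T (P : {set I}) s l :
  P :\: T \subset perp A T -> is_reduced s -> closed_chamber D l ->
  (forall i, i \in T -> coval l i = 0) -> root_cone P (l - W s l) ->
  Rface D T (W s l).
Proof.
move=> /fintype.subsetP PT + lC lT; elim: s => [_ _|i s IH sr].
  by rewrite word_nil; apply: Rface_chamber.
have sr' := reduced_behead sr; have li := reduced_cons_coval sr lC.
have x_cone := chamber_sub_word (all_setT s) sr' lC.
have y_cone : root_cone [set: I]%SET (coval (W s l) i *: alpha i).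
  by apply: root_coneZ => //; apply: root_cone_alpha; rewrite inE.
rewrite sub_word_cons => sumP.
have /(IH sr') sT := root_cone_summand x_cone y_cone sumP.
rewrite word_cons; have [/simple_refl_fix -> //|ln0] := eqVneq (coval (W s l) i) 0.
have iP : i \in P.
  apply: contraNT ln0 => iP; move: sumP; rewrite addrC => sumP.
  have [c [_ /(_ i iP) ci cE]] := root_cone_summand y_cone x_cone sumP.
  have /rcomb_inj/(_ i) :
      rcomb (fun k => coval (W s l) i * intR (sroot i) k) = rcomb c.
    rewrite -cE [in RHS]alphaE scaler_sumr.
    by apply: eq_bigr => k _; rewrite scalerA.
  by rewrite ci /intR ffunE eqxx mulr1 => ->.
have iT : i \notin T by apply: contraNN ln0 => iT; rewrite (Rface_coval sT).
have := @Rface_word T [:: i] _ _ sT; rewrite word_cons word_nil; apply.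
by rewrite /= andbT; apply: PT; rewrite inE iT.
Qed.

(** A common point is u l = w v l for a single dominant l, as a dominant
    representative is unique. Then w fixes l, so l vanishes on red w, and
    l - u l = w (l - v l) is supported on simple roots of the orthogonal of T1
    that w^-1 carries into the span of the orthogonal of T2. Those outside T
    are fixed by w and hence orthogonal to T. *)
Lemma Rface_meet (T1 T2 : {set I}) w :
  inf_witnessed R A T1 -> inf_witnessed R A T2 ->
  min_double_repr D (T1 :|: perp A T1) (T2 :|: perp A T2) w ->
  Rface D T1 `&` (w @` Rface D T2) = Rface D (T1 :|: T2 :|: red D w).
Proof.
move=> T1i T2i [wl wr]; have Ti := inf_witnessed_red T1i T2i wl.
have [[s0 _ wE] _] := wl; have [s [sr sE _]] := reduced_subword s0.
rewrite -{}sE in wE; subst w; set T := _ :|: red D _ in Ti *.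
apply/seteqP; split=> [x [xR1]|x xR]; last first.
  have [xX xT] := (RfaceE _ Ti).1 xR; split.
    by apply/(RfaceE _ T1i); split=> // i iT; apply: xT; rewrite !inE iT.
  exists x.
    by apply/(RfaceE _ T2i); split=> // i iT; apply: xT; rewrite !inE iT orbT.
  apply: word_fix => i si; apply: xT.
  by rewrite finset.in_setU (mem_red sr) ?orbT.
have [_ [l [[u uT1 ->] lC lT1 ->]]] := xR1.
case=> _ [_ [m [[v vT2 ->] mC mT2 ->]]] mE.
have [t [tr tE _]] := reduced_subword (rev u ++ s ++ v).
have tm : W t m = l by rewrite tE !word_cat mE wordK.
have tm' : W t m = m by apply: chamber_fundamental => //; rewrite tm.
have lm : l = m by rewrite -tm tm'.
rewrite -lm in mE mT2.
have sK i : i \in perp A T1 -> nonneg (ract (rev s) (sroot i)).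
  by move=> iT; apply: (min_lrepr_root wl); rewrite inE iT orbT.
have sL i : i \in perp A T2 -> nonneg (ract s (sroot i)).
  by move=> iT; apply: (min_repr_root wr); rewrite inE iT orbT.
have sl : W s l = l by apply: double_coset_fix sL sK uT1 vT2 lC (esym mE).
have [q [qr qE qu]] := reduced_subword u.
have qT1 : all (mem (perp A T1)) q.
  by apply/allP => i /qu; apply: (allP uT1).
rewrite -qE in mE *.
pose P := parallel_part (perp A T1) (rev s) (perp A T2).
apply: (@Rface_orth_support T P) => //.
- apply/fintype.subsetP => k; rewrite finset.in_setD => /andP[kT].
  rewrite inE => /andP[kT1 /forall_inP kT2].
  have kred : k \notin red D (W s).
    by apply: contraNN kT => kr; rewrite finset.in_setU kr orbT.
  have ks : k \notin rev s.
    by apply: contraNN kred; rewrite mem_rev; apply: mem_red.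
  have nk : 0 < ract (rev s) (sroot k) k.
    by rewrite root_act_notin // ffunE eqxx.
  have sk : ract s (sroot k) = sroot k.
    apply: (@root_act_summand (perp A T2) s (ract (rev s) (sroot k))) => //.
    + exact: sK.
    + by move=> i /kT2/eqP.
    + exact: root_act_revK.
  have kT2' : k \in perp A T2.
    by apply: contraTT nk => /kT2/eqP ->.
  rewrite inE; apply/forall_inP => j; rewrite !inE -orbA => /or3P[jT1|jT2|].
  + by move: kT1; rewrite inE => /forall_inP/(_ j jT1).
  + by move: kT2'; rewrite inE => /forall_inP/(_ j jT2).
  + move=> /asboolP[r /reduced_wordP[rE rr] jr]; apply/eqP.
    apply: (fixed_simple_root_orth rr _ _ jr).
      by apply: contraNN kred => kr; rewrite rE (mem_red rr).
    by rewrite -(word_eq_root_act _ rE).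
- move=> i; rewrite finset.in_setU finset.in_setU -orbA => /or3P[/lT1//|/mT2//|].
  rewrite inE => /asboolP[r /reduced_wordP[rE rr] ir].
  by apply: (chamber_fixed_letters rr lC _ ir); rewrite -rE.
- apply: root_cone_parallel; first exact: sK.
    exact: chamber_sub_word.
  rewrite linearB /= -mE wordK -{1}sl wordK.
  exact: chamber_sub_parabolic.
Qed.

(** A face that contains both sides contains the midpoint y of a weight of
    R(T1), taken large off T1, and a generic weight of w R(T2). Minimality of
    w makes y dominant, and y vanishes only where a simple root of T1 is the
    image under w of a simple root of T2. *)
Lemma Rface_join (T1 T2 : {set I}) w :
  inf_witnessed R A T1 -> inf_witnessed R A T2 ->
  min_double_repr D (T1 :|: perp A T1) (T2 :|: perp A T2) w ->
  is_face_join D (Rface D T1) (w @` Rface D T2)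
    (Rface D (inf_core R A (cap_image D T1 w T2))).
Proof.
move=> T1i T2i [wl wr].
have [[s _ wE] _] := wl; subst w.
set J := cap_image D T1 (W s) T2.
have Ji := inf_core_witnessed R A_gcm J.
have JP i : i \in J -> i \in T1 /\
    exists2 j, j \in T2 & ract s (sroot j) = sroot i.
  rewrite inE => /andP[iT1 /existsP[j /andP[jT2 /eqP ji]]]; split=> //.
  exists j => //; apply: intR_inj; apply: rcomb_inj.
  by rewrite -word_alpha -ji alphaE.
have core_sub i : i \in inf_core R A J -> i \in J.
  exact: (fintype.subsetP (inf_core_sub R A J)).
split; first exact: Rface_is_face.
- move=> x /(RfaceE _ T1i)[xX xT]; apply/(RfaceE _ Ji); split=> // i.
  by move=> /core_sub/JP[/xT].
- move=> _ [x /(RfaceE _ T2i)[xX xT] <-]; apply/(RfaceE _ Ji).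
  split; first exact: tits_cone_word.
  by move=> i /core_sub/JP[_ [j /xT <- /coval_word_root ->]].
move=> H Hface T1H T2H x xR.
(* The values of l off T1 outweigh those of W s m, which may be negative. *)
have [m [mC mT2]] := generic_weight T2.
have [l lE] := weight_exists
  (fun i => if i \in T1 then 0 else `|coval (W s m) i| + 1).
have lC : closed_chamber D l.
  by move=> i; rewrite -/(coval l i) lE; case: ifP => // _; rewrite addr_ge0.
pose y := 2^-1 *: l + (1 - 2^-1) *: W s m.
have yE i : coval y i = (coval l i + coval (W s m) i) / 2.
  by rewrite covalD !covalZ; field.
have Hy : H y.
  have [_ _ Hconv _] := Hface; apply: Hconv.
  - by apply: T1H; apply: Rface_chamber => // i iT; rewrite lE iT.
  - apply: T2H; exists m => //; apply: Rface_chamber => // i.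
    by rewrite -mT2 => /eqP.
  - by apply/andP; split; lra.
have sm i : i \in T1 -> coval (W s m) i =
    (d i)^-1 * copair (intR (ract (rev s) (sroot i))) m.
  by move=> _; rewrite -copair_word copair_simple mulKf // gt_eqF.
have spos i : i \in T1 -> nonneg (ract (rev s) (sroot i)).
  by move=> iT; apply: (min_lrepr_root wl); rewrite inE iT.
have yout i : i \notin T1 -> 0 < coval y i.
  move=> iT; rewrite yE lE (negPf iT).
  have := ler_norm (- coval (W s m) i); rewrite normrN; lra.
have yin i : i \in T1 -> 0 <= coval y i.
  move=> iT; rewrite yE lE iT add0r divr_ge0 // sm // mulr_ge0 //.
    by rewrite invr_ge0 ltW.
  exact: copair_ge0 mC (spos i iT).
have yC : closed_chamber D y.
  move=> i; have [/yin//|/yout/ltW//] := boolP (i \in T1).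
have vanJ : vanishing y \subset J.
  apply/fintype.subsetP => i; rewrite inE => /eqP yi.
  have iT1 : i \in T1 by apply: contraPT yi => /yout/gt_eqF/eqP.
  set n := ract (rev s) (sroot i).
  have sn : ract s n = sroot i by apply: root_act_revK.
  have /eqP : copair (intR n) m = 0.
    move: yi; rewrite yE lE iT1 add0r sm // => /eqP.
    by rewrite !mulf_eq0 !invr_eq0 pnatr_eq0 orbF (gt_eqF (d_gt0 i)) => /eqP.
  rewrite psumr_eq0 => [/allP nm|k _]; last first.
    rewrite mulr_ge0 ?ler0z ?spos // mulr_ge0 ?(ltW (d_gt0 k)) //; exact: mC.
  have nT2 k : k \notin T2 -> n k = 0.
    move=> kT; have := nm k (mem_index_enum k).
    rewrite /= !mulf_eq0 mT2 (negPf kT) (gt_eqF (d_gt0 k)) /= orbF intr_eq0.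
    by move/eqP.
  have [j nj] : exists j, 0 < n j.
    apply/existsP; apply: contraT; rewrite negb_exists => /forallP nn.
    have n0 : n = comb 0 0 n n.
      apply/ffunP => j; rewrite ffunE !mul0r addr0; apply/eqP.
      by rewrite eq_le (spos i iT1) andbT leNgt nn.
    have := congr1 (fun f : {ffun I -> int} => f i) sn.
    by rewrite n0 root_act_comb !ffunE !mul0r eqxx.
  have jT2 : j \in T2 by apply: contraTT nj => /nT2 ->.
  rewrite inE iT1; apply/existsP; exists j; rewrite jT2 /= word_alpha.
  rewrite (@root_act_summand T2 s n j i) -?alphaE ?eqxx //.
    by move=> k kT; apply: (min_repr_root wr); rewrite inE kT.
  exact: spos.
apply: (face_contains_Rface Hface Hy yC).
have Vi := inf_core_witnessed R A_gcm (vanishing y).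
have [xX xJ] := (RfaceE _ Ji).1 xR.
apply/(RfaceE _ Vi); split=> // i iV; apply: xJ.
apply: fintype.subsetP iV; apply: inf_core_max => //.
exact: fintype.subset_trans (inf_core_sub _ _ _) vanJ.
Qed.

End WeylGroup.

(** * Inclusions, meets and joins of faces *)

Theorem theorem2p4 (R : realType) (I : finType) (A : I -> I -> int)
  (A_gcm : gen_cartan_mx A) (A_sym : symmetrizable R A)
  (h : vectType R) (D : minimal_realization A h) :
  ((forall (s s' : 'End('Hom(h, R^o))) (T T' : {set I}),
      weyl D s -> weyl D s' -> special R A T -> special R A T' ->
      (s' @` Rface D T' `<=` s @` Rface D T <->
       T \subset T' /\
       exists u v, [/\ parabolic D (perp A T) u, parabolic D T' v
                     & (s^-1 \o s')%VF = (u \o v)%VF])) /\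
   (forall (F F' : set 'Hom(h, R^o)) (T : {set I}),
      is_face D F -> is_face D F' ->
      has_face_type D F T -> has_face_type D F' T ->
      F <> F' -> ~ (F `<=` F') /\ ~ (F' `<=` F))) /\
  (forall (T1 T2 : {set I}) (t : 'End('Hom(h, R^o))),
     special R A T1 -> special R A T2 ->
     min_double_repr D (T1 :|: perp A T1) (T2 :|: perp A T2) t ->
     [/\ special R A (T1 :|: T2 :|: red D t),
         Rface D T1 `&` (t @` Rface D T2) = Rface D (T1 :|: T2 :|: red D t)
       & is_face_join D (Rface D T1) (t @` Rface D T2)
           (Rface D (infty_part R A (cap_image D T1 t T2)))]).
Proof.
have [d d_gt0 d_sym] := A_sym.
have spW T : special R A T <-> inf_witnessed R A T.
  exact: (special_witnessed A_gcm d_gt0 d_sym).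
split; first split.
- move=> _ _ T T' [s _ ->] [s' _ ->] /spW Tinf /spW T'inf.
  exact: (word_Rface_subset A_gcm d_gt0 d_sym).
- move=> F F' T _ _ [/spW Tinf [_ [s _ ->] ->]] [_ [_ [s' _ ->] ->]] neq.
  by split=> /(word_Rface_subset_eq A_gcm d_gt0 d_sym Tinf) FF'; apply: neq.
move=> T1 T2 t /spW T1inf /spW T2inf tmin; split.
- apply/spW; apply: (inf_witnessed_red A_gcm d_gt0 d_sym T1inf T2inf).
  by case: tmin.
- exact: (Rface_meet A_gcm d_gt0 d_sym).
- rewrite (infty_part_core A_gcm d_gt0 d_sym).
  exact: (Rface_join A_gcm d_gt0 d_sym).
Qed.
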